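(* Consider the symmetric $n$-player distributional game described in the context, and suppose that the gross payoffs satisfy (P1)–(P5) and the cost functional satisfies (C1)–(C3). Then there exists a symmetric pure-strategy Nash equilibrium $F^*\in\mathcal F$.
   Context: Let $n\ge 2$ and $X=[0,1]$. Let $\mathcal F$ be the set of cdfs on $X$: right-continuous nondecreasing $F:[0,1]\to[0,1]$ with $F(1)=1$. Each $F\in\mathcal F$ induces a unique Borel probability measure $dF$ on $X$ with $dF([0,x])=F(x)$. $\mathcal F$ carries the topology of weak convergence of the measures $dF$. Each player $i$ chooses $F_i\in\mathcal F$; performances $X_i\sim dF_i$ are drawn independently. Gross payoffs are Borel functions $\pi_i:X^n\to\mathbb R$, $i=1,\dots,n$ (expected payoffs given the realized performances, after averaging over uniform tie-breaking), satisfying: (P1) there is $\bar\pi<\infty$ with $0\le\pi_i\le\bar\pi$ for all $i$; (P2) for every permutation $\sigma$ of $\{1,\dots,n\}$, every $i$ and $x$: $\pi_i(x_{\sigma(1)},\dots,x_{\sigma(n)})=\pi_{\sigma(i)}(x_1,\dots,x_n)$; (P3) $\pi_i$ is continuous at every $x\in X^n$ with $x_i\ne x_j$ for all $j\neq i$; (P4) for each $i$, $x_{-i}$, and $x_i'\ge x_i$: $\pi_i(x_i',x_{-i})\ge\pi_i(x_i,x_{-i})$; (P5) there is a bounded continuous symmetric function $\Pi:X^n\to\mathbb R$ with $\sum_{i=1}^n\pi_i(x)=\Pi(x)$ for all $x\in X^n$. The cost $C:\mathcal F\to\mathbb R$ satisfies: (C1) $C$ is convex and continuous with respect to weak convergence;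 (C2) for each $F\in\mathcal F$ there is a continuous $c_F:X\to\mathbb R$ such that for all $G\in\mathcal F$ the limit $\delta C(F;G-F)=\lim_{\varepsilon\downarrow0}\varepsilon^{-1}\left[C((1-\varepsilon)F+\varepsilon G)-C(F)\right]$ exists and equals $\int_X c_F(x)\,d(G-F)(x)$; (C3) there is $\eta_1>0$ such that $c_F(1)\ge c_F(0)+\bar\pi+\eta_1$ for every $F\in\mathcal F$. Player $i$'s net payoff is $u_i(F_1,\dots,F_n)=\mathbb E[\pi_i(X_1,\dots,X_n)]-C(F_i)$. $F\in\mathcal F$ is a symmetric (pure-strategy Nash) equilibrium if $u_1(F,F,\dots,F)\ge u_1(H,F,\dots,F)$ for all $H\in\mathcal F$. *)

(* Defs.v *)
From HB Require Import structures.
From mathcomp Require Import all_boot all_order all_algebra all_fingroup.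
From mathcomp Require Import all_classical all_reals all_analysis.

Set Implicit Arguments.
Unset Strict Implicit.
Unset Printing Implicit Defensive.
Import Order.TTheory GRing.Theory Num.Theory.
Import numFieldNormedType.Exports.
Local Open Scope classical_set_scope.
Local Open Scope ring_scope.

(* A cdf F : [0,1] -> [0,1] (right-continuous, nondecreasing, F(1) = 1) is
   represented by its extension to the real line by 0 on ]-oo, 0[ and by 1 on
   [1, +oo[.  This extension is unique, so a [cdf01 R] carries no information
   outside [0,1]; an atom at 0 is the jump of the extension at 0. *)
Record cdf01 (R : realType) := Cdf01 {
  cdf01_cumulative :> cumulativeBounded (0 : R) (1 : R) ;
  cdf01_lt0 : forall x : R, x < 0 -> cdf01_cumulative x = 0 ;
  cdf01_ge1 : forall x : R, 1 <= x -> cdf01_cumulative x = 1 }.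

HB.instance Definition _ (R : realType) := gen_eqMixin (cdf01 R).
HB.instance Definition _ (R : realType) := gen_choiceMixin (cdf01 R).

Section cdf01_of_function.
Variables (R : realType) (f : R -> R).
Hypothesis f_nd : nondecreasing f.
Hypothesis f_rc : right_continuous f.
Hypothesis f_lt0 : forall x, x < 0 -> f x = 0.
Hypothesis f_ge1 : forall x, 1 <= x -> f x = 1.

Let f_cvgNy : f @ -oo --> (0 : R).
Proof.
apply: cvg_near_cst; near=> x; apply: f_lt0.
by near: x; exact: nbhs_ninfty_lt.
Unshelve. all: by end_near. Qed.

Let f_cvgy : f @ +oo --> (1 : R).
Proof.
apply: cvg_near_cst; near=> x; apply: f_ge1.
by near: x; exact: nbhs_pinfty_ge.
Unshelve. all: by end_near. Qed.

HB.instance Definition _ := isCumulative.Build R _ R f f_nd f_rc.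
HB.instance Definition _ := isCumulativeBounded.Build R 0 1 f f_cvgNy f_cvgy.

Definition cdf01_of_function : cdf01 R :=
  @Cdf01 R (f : cumulativeBounded (0 : R) (1 : R)) f_lt0 f_ge1.

End cdf01_of_function.

Section mixture.
Context {R : realType}.
Variables (e : R) (F G : cdf01 R).

Let t := Num.max 0 (Num.min e 1).
Let m (x : R) := (1 - t) * F x + t * G x.

Let t_ge0 : 0 <= t. Proof. by rewrite le_max lexx. Qed.
Let t_le1 : 0 <= 1 - t.
Proof. by rewrite subr_ge0 ge_max ler01 ge_min lexx orbT. Qed.

Let m_nd : nondecreasing m.
Proof.
by move=> x y xy; apply: lerD; apply: ler_wpM2l => //;
  apply: cumulative_is_nondecreasing.
Qed.

Let m_rc : right_continuous m.
Proof.
by move=> x; apply: cvgD; apply: cvgMr; exact: cumulative_is_right_continuous.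
Qed.

Let m_lt0 x : x < 0 -> m x = 0.
Proof. by move=> x0; rewrite /m !cdf01_lt0// !mulr0 addr0. Qed.

Let m_ge1 x : 1 <= x -> m x = 1.
Proof. by move=> x1; rewrite /m !cdf01_ge1// !mulr1 subrK. Qed.

(* (1 - e) F + e G.  The weight e is truncated to [0,1], so that [mix] is total
   in e : R; it is only meant for e in [0,1], see [mixE]. *)
Definition mix : cdf01 R := cdf01_of_function m_nd m_rc m_lt0 m_ge1.

Lemma mixE x : 0 <= e <= 1 -> mix x = (1 - e) * F x + e * G x.
Proof.
move=> /andP[e0 e1]; rewrite /mix /= /m.
by rewrite (_ : t = e)// /t (min_idPl e1) (max_idPr e0).
Qed.

End mixture.

Definition dF (R : realType) (F : cdf01 R) : probability (measurableTypeR R) R :=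
  lebesgue_stieltjes_measure F.

Lemma dF_itv (R : realType) (F : cdf01 R) (x : R) : 0 <= x ->
  dF F `[0, x]%classic = (F x)%:E.
Proof.
move=> x0.
have cdfE r : dF F `]-oo, r]%classic = (F r)%:E.
  by rewrite -(cdf_lebesgue_stieltjes_id F r).
have F0 : dF F `]-oo, 0[%classic = 0%E.
  apply/negligibleP; first exact: measurable_itv.
  rewrite (_ : `]-oo, 0[%classic =
      \bigcup_k `]-oo, - (k.+1%:R^-1 : R)]%classic); last first.
    apply/seteqP; split=> [y|y [k _]] /=; rewrite !in_itv/=; last first.
      by move=> /le_lt_trans; apply; rewrite oppr_lt0 invr_gt0.
    move=> y0; have /ltr_add_invr[k] : 0 < - y by rewrite oppr_gt0.
    by rewrite add0r => ky; exists k => //=; rewrite in_itv/= lerNr ltW.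
  apply: negligible_bigcup => k; apply/negligibleP; first exact: measurable_itv.
  by apply: etrans (cdfE _) _; rewrite cdf01_lt0// oppr_lt0 invr_gt0.
have -> : `[0, x]%classic = `]-oo, x]%classic `\` `]-oo, 0[%classic :> set R.
  apply/seteqP; split=> [y|y []] /=; rewrite !in_itv/=.
    by move=> /andP[y0 ->]; split => //; apply/negP; rewrite -leNgt.
  by move=> -> /negP; rewrite -leNgt => ->.
have Fx_fin : (dF F `]-oo, x]%classic < +oo)%E by rewrite cdfE ltry.
rewrite measureD//.
rewrite setIidr; first by apply: etrans (congr2 _ (cdfE x) (congr1 _ F0)) _; rewrite sube0.
by move=> y /=; rewrite !in_itv/= => /ltW y0; exact: le_trans x0.
Qed.

(* The topology of weak convergence on cdfs is the coarsest one that makes all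
   the maps F |-> \int f dF continuous, f ranging over the continuous functions
   on the compact set [0,1]. *)
Section weak_convergence.
Variable R : realType.

Definition test_function :=
  {f : R -> R | {within `[0, 1], continuous f}}.

Definition integrate (F : cdf01 R) : {ptws test_function -> R} :=
  fun f => \int[dF F]_(x in `[0, 1]) (sval f x).

HB.instance Definition _ :=
  Topological.copy (cdf01 R) (initial_topology integrate).

Lemma weak_cvgP (S : set_system (cdf01 R)) (F : cdf01 R) : Filter S ->
  S --> F <->
  forall f : R -> R, {within `[0, 1], continuous f} ->
    \int[dF G]_(x in `[0, 1]) f x @[G --> S] --> \int[dF F]_(x in `[0, 1]) f x.
Proof.
move=> FS; split=> [SF f cf|Scvg].
  pose tf : test_function := exist _ f cf.
  apply: (@cvg_comp _ _ _ integrate (fun u => u tf) S (nbhs (integrate F))).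
    by apply: cvg_trans (@initial_continuous _ _ integrate F); exact: cvg_app.
  exact: (@proj_continuous {classic test_function} (fun=> R) tf).
have Sint : integrate @ S --> (integrate F : {ptws test_function -> R}).
  apply/cvg_sup => -[f cf] A [_ [[W oW <-]] WF] /filterS; apply.
  by apply: (Scvg f cf); exact: open_nbhs_nbhs.
move=> A [_ [[W oW <-]] WF] /filterS; apply.
by apply: Sint; exact: open_nbhs_nbhs.
Qed.

End weak_convergence.

(* The law of a tuple of independent random variables with the given marginals,
   i.e. the finite product of the probability measures P i. *)
Section product_law.
Context {d} {T : measurableType d} {R : realType}.

Definition tuple_cons n (p : T * n.-tuple T) : n.+1.-tuple T :=
  [the n.+1.-tuple T of p.1 :: p.2].

Let measurable_tuple_cons n : measurable_fun setT (@tuple_cons n).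
Proof. by apply: measurable_cons. Qed.

HB.instance Definition _ n := @isMeasurableFun.Build _ _ _ _
  (@tuple_cons n) (@measurable_tuple_cons n).

Fixpoint product_law n : ('I_n -> probability T R) -> probability (n.-tuple T) R :=
  match n with
  | 0 => fun=> \d_([tuple] : 0.-tuple T)
  | n'.+1 => fun P =>
      distribution (P ord0 \x product_law (fun i => P (lift ord0 i)))%E
        (@tuple_cons n')
  end.

Lemma product_law_box n (P : 'I_n -> probability T R) (A : 'I_n -> set T) :
  (forall i, measurable (A i)) ->
  (product_law P [set t | forall i, A i (tnth t i)] = \prod_(i < n) P i (A i))%E.
Proof.
elim: n P A => [|n IH] P A mA.
  rewrite big_ord0 /= diracE mem_set//= => -[].
  by [].
rewrite big_ord_recl /= /distribution /pushforward.
rewrite (_ : _ @^-1` _ =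
  A ord0 `*` [set t | forall i, A (lift ord0 i) (tnth t i)]); last first.
  apply/seteqP; split => [[x t]/= At|[x t]/= [Ax At] i].
    split; first exact: (At ord0).
    by move=> i; have := At (lift ord0 i); rewrite tnthS.
  by have [j ->|->//] := unliftP ord0 i; rewrite tnthS.
rewrite product_measure1E//; first by congr (_ * _)%E; exact: IH.
rewrite (_ : mkset _ = \bigcap_(i in [set: 'I_n])
    ((fun t => tnth t i) @^-1` A (lift ord0 i))).
  apply: fin_bigcap_measurable => // i _.
  by rewrite -[X in measurable X]setTI; exact: measurable_tnth.
by apply/seteqP; split => [t/= At i _|t/= At i]; exact: At.
Qed.

End product_law.

Section game.
Context {R : realType} {n : nat}.

(* X^n *)
Definition cube : set 'rV[R]_n := [set x | forall i, x ord0 i \in `[0, 1]].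

(* Borel measurability of the restriction of f to X^n. *)
Definition borel_on_cube (f : 'rV[R]_n -> R) : Prop :=
  measurable_fun (cube : set (g_sigma_algebraType (@open 'rV[R]_n)))
    (f : g_sigma_algebraType (@open 'rV[R]_n) -> R).

Definition row_of_tuple (t : n.-tuple R) : 'rV[R]_n := \row_i tnth t i.

(* E[f(X_1, ..., X_n)] for independent performances X_j ~ dF_j. *)
Definition expected (f : 'rV[R]_n -> R) (F : 'I_n -> cdf01 R) : R :=
  \int[product_law (fun j => dF (F j))]_(t in row_of_tuple @^-1` cube)
    f (row_of_tuple t).

Variables (pi : 'I_n -> 'rV[R]_n -> R) (C : cdf01 R -> R).

Definition net_payoff (i : 'I_n) (F : 'I_n -> cdf01 R) : R :=
  expected (pi i) F - C (F i).

(* Symmetric equilibrium, i.e. player i gains nothing by deviating to H when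
   everybody else chooses F; the game being symmetric, one player is enough. *)
Definition symmetric_equilibrium (i : 'I_n) (F : cdf01 R) : Prop :=
  forall H : cdf01 R,
    net_payoff i (fun j => if j == i then H else F) <= net_payoff i (fun=> F).

End game.
Arguments cube : clear implicits.

(* Main.v *)
(* Fix the population strategy F and call "gain of H at F" the net payoff of a
   lone deviator to H minus that of a conformist.  If H has no atom, the gain is
   weakly continuous in F: the deviator almost surely ties with nobody, so
   averaging its payoff over H gives a continuous function of the opponents'
   performances, and by symmetry the conformist gets 1/n of the continuous
   total payoff.  For finitely many atomless deviations H_j, let F range over
   their convex combinations; convexity of the cost (via its gradient c_F) makes
   the average gain nonpositive at F, and a Brouwer-type covering argument on
   the simplex yields a combination at which no H_j has a positive gain.  The
   covering lemma is derived from Scarf's combinatorial lemma.  By weak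
   compactness of the cdfs, some F* resists all atomless deviations at once.  An
   arbitrary deviation is no better: moving its atom at 1 down to 0 is
   profitable since c_F(1) - c_F(0) exceeds the largest payoff, and the
   resulting cdf can be replaced by an atomless one that is weakly close to it
   and, up to a small error, first-order dominates it, payoffs being monotone
   in own performance. *)
Require Import Defs.
From mathcomp Require Import all_boot.

Set Implicit Arguments.
Unset Strict Implicit.
Unset Printing Implicit Defensive.

(** * Dominant sets and complete colorings *)

(** Ties are the obstacle: when both the deviator and the population have atoms, the deviator's
    payoff can jump along a weak limit. The closed conditions fed to compactness are therefore
    imposed for atomless deviations only. The average gain is nonpositive because the gross payoff
    is affine in the deviator's own cdf: with the weights of the combination, the deviators earn on
    average exactly what a conformist earns, and only the Jensen gap of the cost is left. Smoothing
    has to lower the cdf, since this moves mass to higher performances. A Lipschitz minorant does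
    so, but it may fall short of 1 at the point 1, and the deficit must be put back elsewhere. The
    deficit tends to 0 exactly when there is no atom at 1, hence the preliminary removal of that
    atom. Weak limits are controlled by two devices: tensor products of tents turn expectations over
    the cube into polynomials in one-dimensional integrals, and compactness rests on a shifted
    comparison of cdfs ([weak_cvg_levy]) that never mentions continuity points. *)

Section scarf.
Variables (T I : finType) (rk : I -> T -> nat) (t0 : T).
Hypothesis rk_inj : forall i, injective (rk i).
Implicit Types (s : {set T}) (D : {set I}) (i j k l : I) (x y z : T).

Definition below i y s := [forall z in s, rk i y <= rk i z].

(** Scarf's condition: no point of [T] is strictly above the minimum of [s] in all the orders of [D]
    at once. For empty [s] it only says that [D] is nonempty. *)
Definition dominant s D := [forall y, [exists i in D, below i y s]].

(** Rooms and doors are the vertices and edges of the graph behind Scarf's lemma. A door of a room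
    arises by removing a point or adding an index, and both operations preserve dominance. *)
Definition room (r : {set T} * {set I}) := dominant r.1 r.2 && (#|r.1| == #|r.2|).

Definition door (d : {set T} * {set I}) :=
  dominant d.1 d.2 && (#|d.2| == #|d.1|.+1).

Definition incident (r d : {set T} * {set I}) :=
  (d.1 \subset r.1) && (r.2 \subset d.2).

Lemma belowP i y s : reflect (forall z, z \in s -> rk i y <= rk i z) (below i y s).
Proof. exact: forall_inP. Qed.

Lemma belowS i y s s' : s \subset s' -> below i y s' -> below i y s.
Proof. by move=> /subsetP ss /belowP ys; apply/belowP => z /ss; exact: ys. Qed.

Lemma belowU1 i y x s : below i y (x |: s) = (rk i y <= rk i x) && below i y s.
Proof.
apply/belowP/andP => [h|[yx /belowP ys] z]; last first.
  by rewrite in_setU1 => /predU1P[->|/ys].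
by split; [exact/h/setU11|apply/belowP => z zs; apply/h/setU1r].
Qed.

Lemma dominantP s D :
  reflect (forall y, exists2 i, i \in D & below i y s) (dominant s D).
Proof.
by apply: (iffP forallP) => h y; [exact/exists_inP/h|exact/exists_inP/h].
Qed.

Lemma dominantS s s' D D' :
  s \subset s' -> D' \subset D -> dominant s' D' -> dominant s D.
Proof.
move=> ss /subsetP DD /dominantP dom; apply/dominantP => y.
by have [i /DD iD ys] := dom y; exists i => //; exact: belowS ys.
Qed.

Definition argmin s i := odflt t0 [pick x in s | below i x s].

Lemma argminP s i x0 : x0 \in s -> argmin s i \in s /\ below i (argmin s i) s.
Proof.
rewrite /argmin => x0s; case: pickP => [x /andP[]//|no].
have [x xs xmin] := arg_minnP (rk i) x0s.
by have /negP[] := no x; apply/andP; split => //; apply/belowP.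
Qed.

Lemma argmin_eq s i x : x \in s -> below i x s -> argmin s i = x.
Proof.
move=> xs /belowP xmin; have [as_ /belowP amin] := argminP i xs.
by apply: (@rk_inj i); apply/eqP; rewrite eqn_leq amin// xmin.
Qed.

(** Dominance tested at a point of [s] itself makes this point minimal in some order of [D]. Hence
    [argmin s] is a bijection from [D] in a nonempty room, while in a door with points it identifies
    exactly one pair of indices. *)
Lemma argmin_imset s D x0 : x0 \in s -> dominant s D -> argmin s @: D = s.
Proof.
move=> x0s /dominantP dom; apply/setP => x; apply/imsetP/idP => [[i _ ->]|xs].
  by have [] := argminP i x0s.
by have [i iD xmin] := dom x; exists i => //; rewrite (argmin_eq xs).
Qed.

Section doors.
Variables (s : {set T}) (D : {set I}) (x0 : T).
Hypotheses (x0s : x0 \in s) (sD : dominant s D) (cD : #|D| = #|s|.+1).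

(** These points are strictly above the minimum of [s] in every order of [D :\ k]: exactly the ones
    that prevent [(s, D :\ k)] from being dominant. *)
Let free k : {set T} := [set x | ~~ [exists l in D :\ k, below l x s]].

Let freePn k x : x \notin free k -> exists2 l, l \in D :\ k & below l x s.
Proof. by rewrite inE negbK => /exists_inP. Qed.

Let freeP k x l : x \in free k -> l \in D -> below l x s -> l = k.
Proof.
rewrite inE => /exists_inPn h lD xl; apply/eqP; apply: contraT => lk.
by have := h l; rewrite !inE lk lD xl => /(_ isT).
Qed.

(** The room entered when the index [k] is released. If nothing obstructs, [k] is dropped; otherwise
    the obstructing point that is highest in the order [k] joins [s], so that no obstruction remains
    above it. *)
Let opposite k : {set T} * {set I} :=
  if [pick x in free k | [forall y in free k, rk k y <= rk k x]] is Some x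
  then (x |: s, D) else (s, D :\ k).

Variant opposite_spec k : {set T} * {set I} -> Prop :=
| OppositeFace of free k = set0 : opposite_spec k (s, D :\ k)
| OppositeCoface x of x \in free k & (forall y, y \in free k -> rk k y <= rk k x) :
    opposite_spec k (x |: s, D).

Let oppositeP k : opposite_spec k (opposite k).
Proof.
rewrite /opposite; case: pickP => [x /andP[xf /forall_inP xmax]|no].
  by apply: OppositeCoface.
have [f0|[y yf]] := set_0Vmem (free k); first exact: OppositeFace.
have [x xf xmax] := arg_maxnP (rk k) yf.
by have /negP[] := no x; apply/andP; split => //; apply/forall_inP.
Qed.

Let free_notin k x : argmin s @: (D :\ k) = s -> x \in free k -> x \notin s.
Proof.
move=> im xf; apply/negP => xs; move: (xs); rewrite -im => /imsetP[l].
rewrite in_setD1 => /andP[lk lD] xE; move/eqP: lk; apply.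
by apply: (freeP xf lD); rewrite xE; have [] := argminP l x0s.
Qed.

Let free_below k x : x \in free k -> below k x s.
Proof.
move=> xf; have /dominantP/(_ x)[l lD xl] := sD.
by rewrite -(freeP xf lD xl).
Qed.

Let opposite_room k : k \in D -> argmin s @: (D :\ k) = s ->
  room (opposite k) && incident (opposite k) (s, D).
Proof.
move=> kD im; rewrite /room /incident; case: oppositeP => [f0|x xf xmax] /=.
  rewrite subxx subD1set !andbT; apply/andP; split.
    by apply/dominantP => y; apply: (@freePn k); rewrite f0 inE.
  by apply/eqP; have := cardsD1 k D; rewrite kD cD => -[].
rewrite subsetUr subxx cardsU1 (free_notin im xf) cD add1n eqxx !andbT.
apply/dominantP => y; have [yf|/freePn[l lDk yl]] := boolP (y \in free k).
  by exists k => //; rewrite belowU1 xmax// free_below.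
have /setD1P[lk lD] := lDk.
exists l => //; rewrite belowU1 yl andbT.
have /forall_inPn[z zs] : ~~ below l x s.
  by apply: contra lk => xl; apply/eqP; exact: freeP xl.
rewrite -ltnNge => /ltnW; apply: leq_trans.
by move/belowP: yl; apply.
Qed.

(** By cardinality, a room behind the door either keeps [s] and loses one index [k], or keeps [D]
    and gains one point, which is the minimum in exactly one order [k]. In both cases bijectivity of
    [argmin] on the room leaves it injective on [D :\ k]. *)
Let room_opposite r : room r -> incident r (s, D) ->
  exists2 k, k \in D & [/\ {in D :\ k &, injective (argmin s)} & r = opposite k].
Proof.
case: r => u C /andP[/= uC cuC] /andP[/= su CD].
have Cu : #|argmin u @: C| == #|C|.
  by rewrite (@argmin_imset _ _ x0) ?(eqP cuC)//; exact: (subsetP su).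
have Cinj : {in C &, injective (argmin u)} by apply/imset_injP.
have x0u := subsetP su _ x0s.
have [us|/subsetPn[x xu xs]] := boolP (u \subset s).
  have uE : u = s by apply/eqP; rewrite eqEsubset us.
  move: Cinj uC cuC; rewrite uE => Cinj uC cuC.
  have /cards1P[k DC] : #|D :\: C| == 1.
    by rewrite cardsD (setIidPr CD) cD -(eqP cuC) subSnn.
  have CE : C = D :\ k.
    by rewrite -DC setDDr setDv set0U (setIidPr CD).
  have kD : k \in D by have := set11 k; rewrite -DC => /setDP[].
  exists k => //; split; first by rewrite -CE.
  rewrite CE; case: oppositeP => // y; rewrite inE => /exists_inPn nb _.
  have /dominantP/(_ y)[l lC yl] := uC.
  by rewrite CE in lC; have /negP := nb l lC.
have cxs : #|x |: s| = #|D| by rewrite cardsU1 xs cD.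
have xsu : x |: s \subset u by rewrite subUset sub1set xu.
have CE : C = D.
  by apply/eqP; rewrite eqEcard CD -cxs -(eqP cuC) subset_leq_card.
have uE : u = x |: s.
  by apply/esym/eqP; rewrite eqEcard xsu cxs (eqP cuC) CE leqnn.
move: Cinj uC Cu; rewrite uE CE => Cinj uC Cu.
have xU := setU11 x s.
have [k kD kx] : exists2 k, k \in D & x = argmin (x |: s) k.
  by apply/imsetP; rewrite (argmin_imset xU).
have argE l : l \in D :\ k -> argmin (x |: s) l = argmin s l.
  move=> /setD1P[lk lD]; have [] := argminP l xU.
  case/setU1P => [lx|ls /(belowS (subsetUr [set x] s)) lb].
    by move: lk; rewrite (Cinj l k) ?eqxx// lx -kx.
  by rewrite (argmin_eq ls lb).
exists k => //; split.
  move=> i j iD jD ij; apply: Cinj; rewrite ?argE//.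
    by move: iD => /setD1P[].
  by move: jD => /setD1P[].
have xf : x \in free k.
  rewrite inE; apply/exists_inPn => l lDk; have /setD1P[lk lD] := lDk.
  apply/negP => xl; move: lk; rewrite (Cinj l k) ?eqxx// -kx.
  by rewrite (argmin_eq xU)// belowU1 leqnn.
have xmax y : y \in free k -> rk k y <= rk k x.
  move=> yf; have /dominantP/(_ y)[l lD] := uC.
  rewrite belowU1 => /andP[yx ys].
  by rewrite -(freeP yf lD ys).
case: oppositeP => [f0|y yf ymax]; first by rewrite f0 inE in xf.
by congr (_ |: _, _); apply: (@rk_inj k); apply/eqP; rewrite eqn_leq ymax ?xmax.
Qed.

(** Since [argmin s] maps [D] onto a set with one element less, a single pair [i], [j] shares its
    minimizer. Injectivity on [D :\ k] forces [k] to be [i] or [j], and for these two the image of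
    [D :\ k] is still all of [s], so both opposites are rooms. *)
Lemma card_door_rooms : #|[set r | room r && incident r (s, D)]| = 2.
Proof.
have im := argmin_imset x0s sD.
have [i [j [iD jD ij eij]]] : exists i j,
    [/\ i \in D, j \in D, i != j & argmin s i = argmin s j].
  have : ~~ dinjectiveb (argmin s) (mem D).
    apply/negP => /dinjectiveP/card_in_imset.
    by rewrite im cD => /n_Sn.
  case/dinjectivePn => i iD [j /andP[ji jD] e].
  by exists i, j; split; rewrite // eq_sym.
have imi : argmin s @: (D :\ i) = s.
  apply/eqP; rewrite eqEsubset; apply/andP; split.
    by apply: subset_trans (imsetS _ (subD1set _ _)) _; rewrite im.
  apply/subsetP => x; rewrite -{1}im => /imsetP[l lD ->]; have [->|li] := eqVneq l i.
    by rewrite eij imset_f// in_setD1 jD eq_sym ij.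
  by rewrite imset_f// in_setD1 li.
have imj : argmin s @: (D :\ j) = s.
  apply/eqP; rewrite eqEsubset; apply/andP; split.
    by apply: subset_trans (imsetS _ (subD1set _ _)) _; rewrite im.
  apply/subsetP => x; rewrite -{1}im => /imsetP[l lD ->]; have [->|lj] := eqVneq l j.
    by rewrite -eij imset_f// in_setD1 iD ij.
  by rewrite imset_f// in_setD1 lj.
have -> : [set r | room r && incident r (s, D)] = [set opposite i; opposite j].
  apply/setP => r; rewrite !inE; apply/idP/orP => [/andP[rr rd]|[]/eqP->].
  - have [k kD [kinj ->]] := room_opposite rr rd.
    have [->|ik] := eqVneq i k; first by left.
    have [->|jk] := eqVneq j k; first by right.
    by move: ij; rewrite (kinj i j) ?eqxx// in_setD1 ?ik ?jk.
  - exact: opposite_room.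
  - exact: opposite_room.
rewrite cards2; case: eqP => // /eqP.
case: oppositeP => [f0|x xf _]; case: oppositeP => [f0'|y yf _].
- by move=> /eqP[/setP/(_ i)]; rewrite !inE eqxx iD ij.
- by move=> /eqP[_ /setP/(_ i)]; rewrite !inE eqxx iD.
- by move=> /eqP[_ /setP/(_ j)]; rewrite !inE eqxx jD.
- move=> /eqP[/setP/(_ x)]; rewrite !inE eqxx/= => /esym/orP[/eqP xy|xs].
    by move: ij; rewrite (@freeP i x j) ?eqxx//; rewrite xy; exact: free_below.
  by have := free_notin imi xf; rewrite xs.
Qed.

End doors.

(** With [i] as the only index, dominance forces the single point of the room to be the maximum of
    [T] in the order [i]. *)
Lemma card_outer_door_rooms i :
  #|[set r | room r && incident r (set0, [set i])]| = 1.
Proof.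
have [x _ xmax] := @arg_maxnP _ t0 xpredT (rk i) isT.
apply/eqP/cards1P; exists ([set x], [set i]); apply/setP => -[u C].
rewrite !inE /room /incident /= sub0set; apply/idP/eqP => [|[-> ->]]; last first.
  rewrite !cards1 eqxx subxx !andbT; apply/dominantP => y; exists i.
    exact: set11.
  by apply/belowP => z /set1P->; exact: xmax.
move=> /andP[/andP[uC cuC]]; rewrite subset1 => /predU1P[CE|/eqP CE]; last first.
  have /dominantP/(_ t0)[l] := uC.
  by rewrite CE inE.
move: cuC uC; rewrite CE cards1 => /cards1P[y ->] /dominantP/(_ x)[l /set1P->].
move=> /belowP/(_ y (set11 _)) xy.
by congr ([set _], _); apply: (@rk_inj i); apply/eqP; rewrite eqn_leq xy andbT; exact: xmax.
Qed.

Section coloring.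
Variables (c : T -> I) (i0 : I).

(** The distinguished colour [i0] is the one allowed to be missing. In a typed door the points carry
    each other colour of [D] exactly once. *)
Definition typed (d : {set T} * {set I}) := (i0 \in d.2) && (c @: d.1 == d.2 :\ i0).

Lemma room_doorP s D d : room (s, D) ->
  reflect ((exists2 x, x \in s & d = (s :\ x, D)) \/
           (exists2 k, k \notin D & d = (s, k |: D)))
    (door d && incident (s, D) d).
Proof.
case: d => v E /andP[/= sD /eqP csD].
apply: (iffP andP) => [[/andP[/= vE /eqP cvE] /andP[/= vs DE]]|].
  have [sv|/subsetPn[x xs xv]] := boolP (s \subset v).
    have vsE : v = s by apply/eqP; rewrite eqEsubset vs.
    have /subsetPn[k kE kD] : ~~ (E \subset D).
      by apply/negP => /subset_leq_card; rewrite cvE vsE csD ltnn.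
    right; exists k => //; congr (_, _) => //; apply/esym/eqP.
    by rewrite eqEcard subUset sub1set kE DE cardsU1 kD cvE vsE csD leqnn.
  have vsx : v \subset s :\ x by rewrite subsetD1 vs.
  have csx := cardsD1 x s; rewrite xs add1n in csx.
  have ED : E = D.
    apply/esym/eqP; rewrite eqEcard DE cvE -csD csx ltnS.
    exact: subset_leq_card.
  left; exists x => //; congr (_, _) => //; apply/eqP.
  by rewrite eqEcard vsx -ltnS -cvE ED -csx csD leqnn.
case=> [[x xs [-> ->]]|[k kD [-> ->]]]; rewrite /door /incident /=.
  rewrite subD1set subxx -csD (cardsD1 x s) xs eqxx andbT; split => //.
  exact: dominantS (subD1set _ _) (subxx _) sD.
rewrite subxx subsetUr cardsU1 kD csD eqxx andbT; split => //.
exact: dominantS (subxx _) (subsetUr _ _) sD.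
Qed.

(** A completely coloured room has one typed door: remove the point of colour [i0], or add [i0] to
    [D] if it is not there. Any other room has none or exactly two. *)
Lemma odd_room_doors r : room r ->
  odd #|[set d | door d && incident r d && typed d]| = (c @: r.1 == r.2).
Proof.
case: r => s D rsD /=; set A := [set d | _].
have AP d : d \in A <-> ((exists2 x, x \in s & d = (s :\ x, D)) \/
    (exists2 k, k \notin D & d = (s, k |: D))) /\ typed d.
  rewrite inE; split => [/andP[/(room_doorP _ rsD)]//|[/(room_doorP _ rsD)-> //]].
have /andP[_ /= /eqP csD] := rsD.
have [csE|/eqP csE] := eqVneq (c @: s) D.
  have cinj : {in s &, injective c} by apply/imset_injP; rewrite csE csD.
  suff [d Ad] : exists d, A = [set d] by rewrite Ad cards1.
  have [iD|iD] := boolP (i0 \in D).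
    move: (iD); rewrite -csE => /imsetP[x xs ix].
    exists (s :\ x, D); apply/setP => d; rewrite inE; apply/idP/eqP => [/AP|->].
      case=> -[[y ys ->]|[k kD ->]] /andP[/= _ /eqP]; last first.
        rewrite csE => /setP/(_ i0); rewrite !inE eqxx iD.
        by [].
      move=> /setP/(_ i0); rewrite !inE eqxx /= => /negbT iy.
      congr (_ :\ _, _); apply/eqP; apply: contraR iy => yx.
      by rewrite ix imset_f// !inE eq_sym yx xs.
    apply/AP; split; first by left; exists x.
    rewrite /typed iD /=; apply/eqP/setP => k; rewrite in_setD1 -csE.
    apply/imsetP/andP => [[y /setD1P[yx ys] ->]|[ki /imsetP[y ys kE]]].
      rewrite imset_f// ix; split => //; apply: contra yx => /eqP/cinj.
      by move=> /(_ ys xs) ->.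
    exists y => //; rewrite in_setD1 ys andbT; apply: contra ki => /eqP yx.
    by rewrite kE yx ix.
  exists (s, i0 |: D); apply/setP => d; rewrite inE; apply/idP/eqP => [/AP|->].
    case=> -[[y ys ->]|[k kD ->]] /andP[/= iE _]; first by rewrite iE in iD.
    by move: iE; rewrite in_setU1 (negbTE iD) orbF => /eqP->.
  apply/AP; split; first by right; exists i0.
  by rewrite /typed /= setU11 setU1K// csE eqxx.
have [->|[d0 d0A]] := set_0Vmem A; first by rewrite cards0.
(* The point [x] is redundant for the colouring. If its colour lies in [D], another point has the
   same colour and removing that twin gives the second typed door; otherwise adding the colour of
   [x] to [D] does. *)
suff [x [xs iD cx cxi]] : exists x,
    [/\ x \in s, i0 \in D, c @: (s :\ x) = D :\ i0 & c x != i0].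
  have cinj : {in s :\ x &, injective c}.
    apply/imset_injP; rewrite cx; apply/eqP.
    have := cardsD1 x s; have := cardsD1 i0 D; rewrite xs iD csD => ->.
    by rewrite !add1n => -[].
  suff [d Ad dx] : exists2 d, A = [set (s :\ x, D); d] & (s :\ x, D) != d.
    by rewrite Ad cards2 dx.
  have xA : (s :\ x, D) \in A.
    by apply/AP; split; [left; exists x|rewrite /typed /= iD cx eqxx].
  have cs : c @: s = c x |: (D :\ i0) by rewrite -cx -imsetU1 setD1K.
  have [cxD|cxD] := boolP (c x \in D).
    have : c x \in D :\ i0 by rewrite in_setD1 cxi.
    rewrite -cx => /imsetP[y ysx cxy]; have /setD1P[yx ys] := ysx.
    exists (s :\ y, D); last first.
      apply: contra yx => /eqP[/setP/(_ y)]; rewrite !inE eqxx ys andbT /=.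
      by move=> /negbT; rewrite negbK.
    apply/setP => d; rewrite in_set2; apply/idP/orP => [/AP|[]/eqP-> //]; last first.
      apply/AP; split; first by left; exists y.
      rewrite /typed iD /= -cx; apply/eqP/setP => k.
      apply/imsetP/imsetP => -[z /setD1P[zx zs] ->].
        have [->|xz] := eqVneq z x; first by exists y.
        by exists z => //; rewrite in_setD1 xz.
      have [->|yz] := eqVneq z y; last by exists z => //; rewrite in_setD1 yz.
      by exists x => //; rewrite in_setD1 eq_sym yx.
    case=> -[[z zs ->]|[k kD ->]] /andP[/= iE /eqP].
      have [->|zx] := eqVneq z x; first by left.
      have [->|zy] := eqVneq z y; first by right.
      move=> cz; have : c z \in c @: (s :\ z).
        by rewrite cz -cx imset_f// in_setD1 zx.
      case/imsetP => u /setD1P[uz us] czu.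
      have [ux|ux] := eqVneq u x.
        by case/eqP: zy; apply: cinj => //; rewrite ?in_setD1 ?zx// czu ux.
      by case/eqP: uz; apply: cinj => //; rewrite in_setD1 ?zx ?ux.
    move=> cE; have : k \in c @: s.
      rewrite cE in_setD1 setU11 andbT; apply: contra kD => /eqP->.
      by [].
    rewrite cs in_setU1 in_setD1 (negbTE kD) andbF orbF => /eqP kx.
    by rewrite kx cxD in kD.
  exists (s, c x |: D); last first.
    by apply: contra cxD => /eqP[_ ->]; rewrite setU11.
  apply/setP => d; rewrite in_set2; apply/idP/orP => [/AP|[]/eqP-> //]; last first.
    apply/AP; split; first by right; exists (c x).
    rewrite /typed /= in_setU1 iD orbT /= cs; apply/eqP/setP => k.
    rewrite !inE; have [->|//] := eqVneq k i0.
    by rewrite orbF eq_sym (negbTE cxi).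
  case=> -[[z zs ->]|[k kD ->]] /andP[/= iE /eqP].
    have [->|zx] := eqVneq z x; first by left.
    move=> cz; have : c x \in c @: (s :\ z).
      by rewrite imset_f// in_setD1 eq_sym zx.
    by rewrite cz in_setD1 (negbTE cxD) andbF.
  move=> cE; right; have : k \in c @: s.
    rewrite cE in_setD1 setU11 andbT; apply: contra kD => /eqP->.
    by [].
  by rewrite cs in_setU1 in_setD1 (negbTE kD) andbF orbF => /eqP->.
have /AP[[[x xs dE]|[k kD dE]]] := d0A; rewrite dE => /andP[/= iE /eqP cE].
  exists x; split => //; apply/eqP => cxi; apply: csE.
  by rewrite -(setD1K xs) imsetU1 cE cxi setD1K.
have ki : k != i0.
  by apply/eqP => ki; apply: csE; rewrite cE ki setU1K// -ki.
have iD : i0 \in D by move: iE; rewrite in_setU1 eq_sym (negbTE ki).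
have : k \in c @: s by rewrite cE in_setD1 ki setU11.
case/imsetP => x xs kx.
have cinj : {in s &, injective c}.
  apply/imset_injP; rewrite cE csD.
  have := cardsD1 i0 (k |: D); rewrite iE cardsU1 kD !add1n => -[<-].
  by [].
exists x; split => //; last by rewrite -kx.
apply/setP => l; rewrite in_setD1; apply/imsetP/andP.
  case=> y /setD1P[yx ys] lE; have : l \in c @: s by rewrite lE imset_f.
  rewrite cE => /setD1P[li /setU1P[lk|lD]]; last by [].
  by case/eqP: yx; apply: cinj => //; rewrite -lE lk.
case=> li lD; have : l \in c @: s by rewrite cE in_setD1 li in_setU1 lD orbT.
case/imsetP => y ys lE; exists y => //; rewrite in_setD1 ys andbT.
by apply: contra kD => /eqP yx; rewrite kx -yx -lE.
Qed.

End coloring.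

(* Parity: every door is shared by two rooms, except for the outer door
   (set0, [set i0]), which lies in only one. *)
Lemma colorful_room (c : T -> I) (i0 : I) :
  exists r, room r && (c @: r.1 == r.2).
Proof.
apply/existsP; apply: contraT; rewrite negb_exists => /forallP nocol.
pose P d := door d && typed c i0 d.
have : \sum_(r | room r) \sum_(d | incident r d && P d) 1 =
       \sum_(d | P d) \sum_(r | [&& room r, incident r d & P d]) 1.
  by apply: exchange_big_dep => r d _ /andP[].
have oddsum (J : finType) (Q : pred J) (F : J -> nat) :
    odd (\sum_(j | Q j) F j) = \big[addb/false]_(j | Q j) odd (F j).
  exact: (big_morph odd oddD).
move/(congr1 odd); rewrite !oddsum big1 => [|r rr]; last first.
  rewrite sum1_card; have := nocol r; rewrite rr /= => /negbTE <-.
  rewrite -(odd_room_doors c i0 rr); congr odd; apply: eq_card => d.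
  by rewrite inE unfold_in /= /P; case: (door d); case: (incident r d) => //.
have cardP d : P d -> \sum_(r | [&& room r, incident r d & P d]) 1 =
    #|[set r | room r && incident r d]|.
  move=> Pd; rewrite sum1_card; apply: eq_card => r.
  by rewrite inE unfold_in /= Pd andbT.
have P0 : P (set0, [set i0]).
  rewrite /P /door /typed /= cards1 cards0 set11 imset0 setDv !eqxx !andbT.
  apply/dominantP => y; exists i0; first exact: set11.
  by apply/belowP => z; rewrite inE.
rewrite (bigD1 (set0, [set i0])) //= cardP// card_outer_door_rooms.
rewrite big1 // => -[s D] /andP[Pd d0]; rewrite cardP//.
have /andP[/andP[/= sD /eqP csD] /andP[/= iD /eqP cs]] := Pd.
have [s0|[x xs]] := set_0Vmem s; last by rewrite (card_door_rooms xs).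
case/negP: d0; rewrite s0; apply/eqP; congr (_, _).
move: cs; rewrite s0 imset0 => /esym/eqP; rewrite setD_eq0 subset1.
by case/predU1P => // D0; rewrite (eqP D0) inE in iD.
Qed.
End scarf.

(** * Completely coloured cells among the integer points of a dilated simplex *)

Section grid.
Variables (k N : nat) (i0 : 'I_k).

Notation point := {ffun 'I_k -> 'I_N.+1}.
Notation grid := {x : point | \sum_i x i == N}.

Let t0 : grid.
Proof.
exists [ffun i => if i == i0 then ord_max else ord0].
rewrite (bigD1 i0) //= ffunE eqxx big1 ?addn0// => i /negbTE ii0.
by rewrite ffunE ii0.
Defined.

(* Ties between equal coordinates are broken by an enumeration of the grid. *)
Let rk (i : 'I_k) (x : grid) : nat := val x i * #|{: grid}| + enum_rank x.

Let rk_inj i : injective (rk i).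
Proof.
move=> x y /(congr1 (modn^~ #|{: grid}|)); rewrite /rk !modnMDl.
by rewrite !modn_small// => /val_inj/enum_rank_inj.
Qed.

Let rk_le i x y : rk i x <= rk i y -> val x i <= val y i.
Proof.
move=> /(leq_div2r #|{: grid}|); rewrite /rk.
have g0 : 0 < #|{: grid}| by apply/card_gt0P; exists t0.
by rewrite !divnMDl// !divn_small// !addn0.
Qed.

(** Let [m i] be the minimum of coordinate [i] over a completely coloured room with index set [C].
    By dominance no grid point exceeds [m i] for all [i] in [C], so the sum of the [m i + 1] over
    [C] is greater than [N]. All coordinate sums being [N], the total excess of a point over these
    minima is less than [#|C| <= k]. This bounds the width of the cell and also the coordinates
    whose colour is missing. *)
Lemma colorful_grid_cell (c : point -> 'I_k) : exists s : {set point},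
  [/\ exists x, x \in s,
      forall x, x \in s -> \sum_i x i = N,
      forall x y i, x \in s -> y \in s -> x i < y i + k &
      forall i, (exists2 x, x \in s & c x = i) \/
                (forall x, x \in s -> x i < k)].
Proof.
have [[s C] /andP[/andP[/= dom /eqP cs] /eqP/= cC]] :=
  colorful_room t0 rk_inj (c \o val) i0.
have [x0 x0s] : exists x, x \in s.
  have [s0|[x xs]] := set_0Vmem s; last by exists x.
  have [l] := dominantP _ _ _ dom t0.
  by rewrite -cC s0 imset0 inE.
have [l lC] : exists l, l \in C by exists (c (val x0)); rewrite -cC; apply/imsetP; exists x0.
pose m i : nat := val (argmin rk t0 s i) i.
have m_le i x : x \in s -> m i <= val x i.
  move=> xs; have [_ /belowP/(_ _ xs)] := argminP rk t0 i xs.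
  exact: rk_le.
pose M := \sum_(i in C) (m i).+1.
have ltN : N < M.
  rewrite ltnNge; apply/negP => sN.
  (* If there were room for it, this would be a grid point above every minimum: each is raised by
     one and the surplus goes to the index [l]. *)
  pose v i := if i \in C then
    (m i).+1 + (if i == l then N - M else 0) else 0.
  have sumv : \sum_i v i = N.
    rewrite -big_mkcond big_split /= -[RHS](subnKC sN); congr (_ + _).
    rewrite (bigD1 l) //= eqxx big1 ?addn0// => i /andP[_ /negbTE->].
    by [].
  have v_lt i : v i < N.+1 by rewrite ltnS -sumv (bigD1 i)//= leq_addr.
  have yP : \sum_i [ffun i => Ordinal (v_lt i)] i == N.
    by rewrite -[X in _ == X]sumv; apply/eqP/eq_bigr => i _; rewrite ffunE.
  have [i iC yi] := dominantP _ _ _ dom (exist _ [ffun i => Ordinal (v_lt i)] yP).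
  have [as_ _] := argminP rk t0 i x0s.
  move/belowP: yi => /(_ _ as_)/rk_le; rewrite -/(m i) /= ffunE /= /v iC.
  by rewrite leqNgt addSn ltnS leq_addr.
have sumC x : x \in s -> \sum_(i in C) m i + \sum_i (val x i - (if i \in C then m i else 0)) = N.
  move=> xs; rewrite big_mkcond -big_split /= -[RHS](eqP (valP x)).
  apply: eq_bigr => i _; rewrite subnKC//.
  by case: ifP => // _; exact: m_le.
have ltk x i : x \in s -> val x i - (if i \in C then m i else 0) < k.
  move=> /sumC; rewrite [X in _ + X](bigD1 i) //= addnA => xN.
  have : \sum_(i in C) m i + (val x i - (if i \in C then m i else 0)) < \sum_(i in C) m i + #|C|.
    apply: (@leq_ltn_trans N); first by apply: leq_trans (leq_addr _ _) (eq_leq xN).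
    apply: leq_trans ltN _; rewrite -sum1_card -big_split /=.
    by apply: leq_sum => j _; rewrite addn1.
  rewrite ltn_add2l => /leq_trans; apply.
  by rewrite -[X in _ <= X]card_ord max_card.
exists [set val x | x in s]; split.
- by exists (val x0); apply/imsetP; exists x0.
- by move=> _ /imsetP[x xs ->]; exact/eqP/(valP x).
- move=> _ _ i /imsetP[x xs ->] /imsetP[y ys ->].
  have := ltk x i xs; case: ifP => iC; last first.
    by rewrite subn0 => /leq_trans; apply; exact: leq_addl.
  rewrite ltn_subLR ?m_le// => /leq_trans; apply.
  by rewrite leq_add2r m_le.
- move=> i; have [iC|iC] := boolP (i \in C); [left|right].
    by move: iC; rewrite -cC => /imsetP[x xs ->]; exists (val x) => //; apply/imsetP; exists x.
  by move=> _ /imsetP[x /ltk-/(_ i) + ->]; rewrite (negbTE iC) subn0.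
Qed.

End grid.

(* From here on set0, setP, subsetP... refer to classical sets instead of {set T}. *)
From HB Require Import structures.
From mathcomp Require Import all_boot all_order all_algebra all_fingroup finmap.
From mathcomp Require Import all_classical all_reals all_analysis.
From mathcomp Require Import measurable_realfun lra.

Import Order.TTheory GRing.Theory Num.Theory.
Import numFieldNormedType.Exports.
Local Open Scope classical_set_scope.
Local Open Scope ring_scope.

(** * A covering lemma on the simplex *)

Lemma cvg_sumr (R : numFieldType) (V : normedModType R) (T : Type)
    (F : set_system T) (I : Type) (r : seq I) (P : pred I) (f : I -> T -> V)
    (a : I -> V) : Filter F ->
  (forall i, P i -> f i x @[x --> F] --> a i) ->
  (\sum_(i <- r | P i) f i x) @[x --> F] --> \sum_(i <- r | P i) a i.
Proof. by move=> FF; exact: (cvg_big add_continuous). Qed.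

Section simplex.
Variables (R : realType) (k : nat).

Definition simplex : set 'rV[R]_k :=
  [set x | (forall i, 0 <= x ord0 i) /\ \sum_i x ord0 i = 1].

Lemma ball_rowP (x y : 'rV[R]_k) (e : R) :
  0 < e -> ball x e y <-> forall i, `|x ord0 i - y ord0 i| < e.
Proof.
move=> e0; split=> [[_ xy] i|xy]; first exact: xy.
by split=> // i j; rewrite ord1; exact: xy.
Qed.

Lemma simplex_le1 x i : simplex x -> x ord0 i <= 1.
Proof.
move=> [x0 <-]; rewrite (bigD1 i)//= lerDl.
by apply: sumr_ge0 => j _.
Qed.

Lemma compact_simplex : compact simplex.
Proof.
have cB : compact [set x : 'rV[R]_k | forall i, (fun=> `[0, 1]%classic) i (x ord0 i)].
  apply: (@rV_compact R k (fun=> `[0, 1]%classic)) => i.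
  exact: segment_compact.
apply: (subclosed_compact _ cB) => [|x xs i /=]; last first.
  by rewrite in_itv/= simplex_le1// andbT; case: xs.
have -> : simplex = (\bigcap_(i in [set: 'I_k]) [set x | 0 <= x ord0 i]) `&`
    [set x | \sum_i x ord0 i = 1].
  apply/seteqP; split=> x /= [x0 x1]; split => //= i; first by move=> _; apply: x0.
  by apply: x0.
apply: closedI.
  apply: closed_bigI => i _.
  apply: (@preimage_closed 'rV[R]_k R (fun x : 'rV[R]_k => x ord0 i) [set y : R | 0 <= y]).
    by move=> x _; exact: coord_continuous.
  exact: closed_ge.
apply: (@preimage_closed _ _ (fun x : 'rV[R]_k => \sum_i x ord0 i) [set y : R | y = 1]).
  move=> x _; apply: cvg_sumr => [|i _]; first exact: nbhs_filter.
  exact: coord_continuous.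
exact: closed_eq.
Qed.

(** A KKM-type theorem for the closed sets [q i <= 0], which cover the simplex and each contain the
    face [x_i = 0]. Grid points are coloured by a set containing them. At a cluster point of ever
    finer cells, a colour that occurs is inherited by closedness, and one that is missing makes the
    coordinate vanish, where the boundary hypothesis takes over. *)
Lemma simplex_covering (i0 : 'I_k) (q : 'I_k -> 'rV[R]_k -> R) :
  (forall i, {within simplex, continuous q i}) ->
  (forall x, simplex x -> exists i, q i x <= 0) ->
  (forall x i, simplex x -> x ord0 i = 0 -> q i x <= 0) ->
  exists2 x, simplex x & forall i, q i x <= 0.
Proof.
move=> qc qcover qbd.
have cell N : exists z, simplex z /\ forall i,
    (exists y, [/\ simplex y, forall j, `|z ord0 j - y ord0 j| <= k%:R / N.+1%:R & q i y <= 0])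
    \/ z ord0 i <= k%:R / N.+1%:R.
  pose pt (x : {ffun 'I_k -> 'I_N.+2}) : 'rV[R]_k := \row_i ((x i)%:R / N.+1%:R).
  have ptS (x : {ffun 'I_k -> 'I_N.+2}) : (\sum_i x i = N.+1)%N -> simplex (pt x).
    move=> xN; split=> [i|]; first by rewrite mxE divr_ge0.
    under eq_bigr do rewrite mxE.
    by rewrite -mulr_suml -natr_sum xN divff.
  pose c x := odflt i0 [pick i | q i (pt x) <= 0].
  have [s [[x0 x0s] sN sd sc]] := @colorful_grid_cell k N.+1 i0 c.
  exists (pt x0); split; first exact/ptS/sN.
  move=> i; case: (sc i) => [[x xs cx]|xi]; last first.
    by right; rewrite mxE ler_pM2r ?invr_gt0// ler_nat ltnW// xi.
  left; exists (pt x); split; first exact/ptS/sN.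
    move=> j; rewrite !mxE -mulrBl normrM [X in _ * X]ger0_norm ?invr_ge0//.
    rewrite ler_pM2r ?invr_gt0// ler_norml.
    have := sd x x0 j xs x0s; have := sd x0 x j x0s xs.
    by rewrite -!(ltr_nat R) !natrD; lra.
  move: cx; rewrite /c; case: pickP => [j qj <- //|no].
  by have [j qj] := qcover _ (ptS _ (sN _ xs)); have := no j; rewrite qj.
have [z zP] := choice cell.
have [p [ps pz]] : simplex `&` cluster (z @ \oo) !=set0.
  apply: compact_simplex; exists 0%N => // N _ /=.
  by have [] := zP N.
exists p => // i; rewrite leNgt; apply/negP => qp.
have pi0 : 0 < p ord0 i.
  rewrite lt_neqAle; case: (ps) => -> _; rewrite andbT eq_sym.
  by apply: contraL qp => /eqP/(qbd _ _ ps); rewrite -leNgt.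
have [e /= e0 eP] : exists2 e, 0 < e & forall y, ball p e y -> simplex y -> 0 < q i y.
  have /subspace_continuousP/(_ p ps) := qc i.
  move=> /(_ [set t | 0 < t]) nb.
  have {}nb : nbhs p (fun t => simplex t -> 0 < q i t).
    by apply: nb; apply: open_nbhs_nbhs; split; [exact: open_gt|].
  by move/nbhs_ballP : nb => [e /= e0 eP]; exists e.
(* Two steps of length [d] separate [p] from the coloured point, and [p_i] from 0 for a missing
   colour. Halving both [e] and [p_i] contradicts either alternative. *)
have [d [d0 de dp]] : exists d : R, [/\ 0 < d, d <= e / 2 & d <= p ord0 i / 2].
  exists (Num.min e (p ord0 i) / 2).
  by rewrite divr_gt0 ?lt_min ?e0// !ler_pM2r// !ge_min !lexx orbT.
have [N [kN zp]] : exists N, k%:R / N.+1%:R < d /\ ball p d (z N).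
  have [] := pz (z @` [set N | k%:R / N.+1%:R < d]) (ball p d).
  - have k1 : 0 < k.+1%:R :> R by [].
    have dk0 : 0 < d / k.+1%:R by rewrite divr_gt0.
    have := near_infty_natSinv_lt (PosNum dk0); apply: filterS => N /= Nd.
    exists N => //=; move: Nd; rewrite ltr_pdivlMr// => /le_lt_trans; apply.
    by rewrite mulrC ler_wpM2l// ler_nat.
  - exact: nbhsx_ballx.
  - by move=> _ [[N kN <-] zp]; exists N.
move/(ball_rowP _ _ d0) in zp.
have [_ /(_ i)[[y [ys zy qy]]|zi]] := zP N.
  have := eP y _ ys; rewrite ltNge qy => /(_ _)/negP; apply => //.
  apply/ball_rowP => // j; have := zp j; have := zy j.
  move: de kN; rewrite !ler_norml !ltr_norml; move: (_ / _) => r.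
  by move=> de rd /andP[h3 h4] /andP[h5 h6]; apply/andP; split; lra.
by have := zp i; rewrite ltr_norml => /andP[_]; move: zi dp kN; move: (_ / _) => r; lra.
Qed.

End simplex.

(** * Integrals of bounded functions and product laws *)

Section bounded_functions.
Context d (T : measurableType d) (R : realType).
Implicit Types (f g : T -> R) (P : probability T R).

Lemma bounded_integrable P f (M : R) :
  measurable_fun setT f -> (forall x, `|f x| <= M) ->
  P.-integrable setT (EFin \o f).
Proof.
move=> mf fM; apply: measurable_bounded_integrable => //.
  by rewrite (le_lt_trans (probability_le1 P measurableT))// ltry.
exists M; split; first exact: num_real.
by move=> y My x _; exact: le_trans (fM x) (ltW My).
Qed.

Lemma EFin_Rintegral P f (M : R) :
  measurable_fun setT f -> (forall x, `|f x| <= M) ->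
  (\int[P]_x f x)%:E = (\int[P]_x (f x)%:E)%E.
Proof.
move=> mf fM; rewrite /Rintegral fineK//.
exact: (integrable_fin_num measurableT (bounded_integrable P mf fM)).
Qed.

Lemma Rintegral_prob_cst P (r : R) : \int[P]_x r = r.
Proof. rewrite Rintegral_cst // -[RHS]mulr1; congr (_ * _). by rewrite [X in fine X](@probability_setT _ _ _ P). Qed.

Lemma le_Rintegral_prob P f g (M N : R) :
  measurable_fun setT f -> (forall x, `|f x| <= M) ->
  measurable_fun setT g -> (forall x, `|g x| <= N) ->
  (forall x, f x <= g x) -> \int[P]_x f x <= \int[P]_x g x.
Proof.
move=> mf fM mg gN fg; apply: le_Rintegral => //.
- exact: bounded_integrable fM.
- exact: bounded_integrable gN.
Qed.

Lemma Rintegral_prob_norm_le P f (M : R) :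
  measurable_fun setT f -> (forall x, `|f x| <= M) -> `|\int[P]_x f x| <= M.
Proof.
move=> mf fM; apply: le_trans (le_normr_Rintegral _ _) _ => //.
  exact: bounded_integrable fM.
rewrite -[leRHS](Rintegral_prob_cst P).
apply: (@le_Rintegral_prob _ _ _ M M) => //.
- exact: measurableT_comp.
- by move=> x; rewrite normr_id.
- by move=> x; rewrite ger0_norm// (le_trans _ (fM x)).
Qed.

Lemma Rintegral_prob_distB P f g (M N e : R) :
  measurable_fun setT f -> (forall x, `|f x| <= M) ->
  measurable_fun setT g -> (forall x, `|g x| <= N) ->
  (forall x, `|f x - g x| <= e) -> `|\int[P]_x f x - \int[P]_x g x| <= e.
Proof.
move=> mf fM mg gN fg; rewrite -RintegralB//.
- by apply: Rintegral_prob_norm_le => //; exact: measurable_realfun.measurable_funB.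
- exact: bounded_integrable fM.
- exact: bounded_integrable gN.
Qed.

Lemma Rintegral_prob_sum P (I : Type) (r : seq I) (F : I -> T -> R) (M : I -> R) :
  (forall i, measurable_fun setT (F i)) -> (forall i x, `|F i x| <= M i) ->
  \int[P]_x (\sum_(i <- r) F i x) = \sum_(i <- r) \int[P]_x F i x.
Proof.
move=> mF FM; elim: r => [|i r IH].
  under eq_Rintegral do rewrite big_nil.
  by rewrite big_nil Rintegral_prob_cst.
under eq_Rintegral do rewrite big_cons.
rewrite big_cons RintegralD// ?IH//.
  exact: bounded_integrable (FM i).
apply: (@bounded_integrable _ _ (\sum_(j <- r) M j)).
  exact: measurable_sum.
by move=> x; apply: le_trans (ler_norm_sum _ _ _) _; exact: ler_sum.
Qed.

End bounded_functions.

Section fubini.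
Context d1 d2 (X : measurableType d1) (Y : measurableType d2) (R : realType).
Variables (P : probability X R) (Q : probability Y R) (f : X * Y -> R) (M : R).
Hypotheses (mf : measurable_fun setT f) (f0 : forall z, 0 <= f z)
  (fM : forall z, f z <= M).

Let mfE : measurable_fun setT (EFin \o f).
Proof. exact/measurable_EFinP. Qed.

Let fn z : `|f z| <= M. Proof. by rewrite ger0_norm. Qed.

Let f0E z : (0 <= (EFin \o f) z)%E. Proof. by rewrite lee_fin. Qed.

Let mf1 x : measurable_fun setT (fun y => f (x, y)).
Proof. exact: measurableT_comp. Qed.

Let mf2 y : measurable_fun setT (fun x => f (x, y)).
Proof. exact: measurableT_comp. Qed.

Lemma measurable_Rintegral2 : measurable_fun setT (fun x => \int[Q]_y f (x, y)).
Proof.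
apply/measurable_EFinP; have := measurable_fun_fubini_tonelli_F (m2 := Q) _ mfE f0E.
by congr measurable_fun; apply/funext => x /=; rewrite (EFin_Rintegral _ _ (fun y => fn (x, y))).
Qed.

Lemma measurable_Rintegral1 : measurable_fun setT (fun y => \int[P]_x f (x, y)).
Proof.
apply/measurable_EFinP; have := measurable_fun_fubini_tonelli_G (m1 := P) _ mfE f0E.
by congr measurable_fun; apply/funext => y /=; rewrite (EFin_Rintegral _ _ (fun x => fn (x, y))).
Qed.

Lemma Rintegral_prod12 :
  \int[(P \x Q)%E]_z f z = \int[P]_x \int[Q]_y f (x, y).
Proof.
rewrite /Rintegral (fubini_tonelli1 _ mfE)//; congr fine.
by apply: eq_integral => x _; exact: esym (EFin_Rintegral Q (mf1 x) (fun y => fn (x, y))).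
Qed.

Lemma Rintegral_prod21 :
  \int[(P \x Q)%E]_z f z = \int[Q]_y \int[P]_x f (x, y).
Proof.
rewrite /Rintegral (fubini_tonelli2 _ mfE)//; congr fine.
by apply: eq_integral => y _; exact: esym (EFin_Rintegral P (mf2 y) (fun x => fn (x, y))).
Qed.

End fubini.

Section pushforward.
Context d (T : measurableType d) (R : realType).

Lemma Rintegral_pushforward d' (Y : measurableType d') (P : probability T R)
    (X : {mfun T >-> Y}) (f : Y -> R) :
  measurable_fun setT f -> (forall z, 0 <= f z) ->
  \int[distribution P X]_y f y = \int[P]_x f (X x).
Proof.
move=> mf f0; rewrite /Rintegral; congr fine.
rewrite ge0_integral_distribution//.
exact/measurable_EFinP.
Qed.

End pushforward.

Section product_law_theory.
Context d (T : measurableType d) (R : realType).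
Variables (n : nat) (f : n.+1.-tuple T -> R) (M : R).
Hypotheses (mf : measurable_fun setT f) (f0 : forall t, 0 <= f t)
  (fM : forall t, f t <= M).

Let mfc : measurable_fun setT (f \o @tuple_cons _ T n).
Proof. exact: measurableT_comp. Qed.

Lemma product_lawS12 (P : 'I_n.+1 -> probability T R) :
  \int[product_law P]_t f t =
  \int[P ord0]_x \int[product_law (fun i => P (lift ord0 i))]_t f (tuple_cons (x, t)).
Proof.
have -> : \int[product_law P]_t f t =
    \int[(P ord0 \x product_law (fun i => P (lift ord0 i)))%E]_z f (tuple_cons z).
  exact: (@Rintegral_pushforward _ _ _ _ _ (P ord0 \x product_law (fun i => P (lift ord0 i)))%E
    (@tuple_cons _ T n) f mf f0).
exact: (Rintegral_prod12 (P ord0) (product_law (fun i => P (lift ord0 i))) mfc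
  (fun z => f0 _) (fun z => fM _)).
Qed.

Lemma product_lawS21 (P : 'I_n.+1 -> probability T R) :
  \int[product_law P]_t f t =
  \int[product_law (fun i => P (lift ord0 i))]_t \int[P ord0]_x f (tuple_cons (x, t)).
Proof.
have -> : \int[product_law P]_t f t =
    \int[(P ord0 \x product_law (fun i => P (lift ord0 i)))%E]_z f (tuple_cons z).
  exact: (@Rintegral_pushforward _ _ _ _ _ (P ord0 \x product_law (fun i => P (lift ord0 i)))%E
    (@tuple_cons _ T n) f mf f0).
exact: (Rintegral_prod21 (P ord0) (product_law (fun i => P (lift ord0 i))) mfc
  (fun z => f0 _) (fun z => fM _)).
Qed.

End product_law_theory.

Section product_law_prod.
Context d (T : measurableType d) (R : realType).

Lemma product_law_prod n (P : 'I_n -> probability T R) (f : 'I_n -> T -> R) :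
  (forall i, measurable_fun setT (f i)) -> (forall i x, 0 <= f i x <= 1) ->
  \int[product_law P]_t (\prod_i f i (tnth t i)) = \prod_i \int[P i]_x f i x.
Proof.
move=> mf f01.
have g01 m (g : 'I_m -> T -> R) (t : m.-tuple T) : (forall i x, 0 <= g i x <= 1) ->
    0 <= \prod_i g i (tnth t i) <= 1.
  move=> g01; rewrite prodr_ge0/=; last by move=> i _; case/andP: (g01 i (tnth t i)).
  by apply: Num.Theory.prodr_ile1 => i.
have mg m (g : 'I_m -> T -> R) : (forall i, measurable_fun setT (g i)) ->
    measurable_fun setT (fun t : m.-tuple T => \prod_i g i (tnth t i)).
  move=> mg; apply: measurable_prod => i _.
  by apply: measurableT_comp => //; exact: measurable_tnth.
elim: n P f mf f01 => [|n IH] P f mf f01.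
  under eq_Rintegral do rewrite big_ord0.
  by rewrite big_ord0 Rintegral_prob_cst.
rewrite (@product_lawS12 _ _ _ _ _ 1) //; last 3 first.
- exact: mg.
- by move=> t; have /andP[] := g01 _ f t f01.
- by move=> t; have /andP[] := g01 _ f t f01.
rewrite big_ord_recl -IH// -RintegralZr//; last first.
  apply: (@bounded_integrable _ _ _ _ _ 1) => // x.
  by have /andP[? ?] := f01 ord0 x; rewrite ger0_norm.
apply: eq_Rintegral => x _; rewrite -RintegralZl//; last first.
  apply: (@bounded_integrable _ _ _ _ _ 1) => [|t].
    exact: (mg n (fun i => f (lift ord0 i)) (fun i => mf _)).
  by have /andP[? ?] := g01 _ (fun i => f (lift ord0 i)) t (fun i => f01 _); rewrite ger0_norm.
apply: eq_Rintegral => t _; rewrite big_ord_recl; congr (_ * _).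
by apply: eq_bigr => i _; rewrite tnthS.
Qed.

End product_law_prod.

Section product_law_perm.
Context d (T : measurableType d) (R : realType) (n : nat).
Implicit Type s : 'S_n.

Definition tuple_perm s (t : n.-tuple T) : n.-tuple T := [tuple tnth t (s i) | i < n].

Lemma measurable_tuple_perm s : measurable_fun setT (tuple_perm s).
Proof.
apply/measurable_fun_tnthP => i; rewrite (_ : _ \o _ = fun t => tnth t (s i)).
  exact: measurable_tnth.
by apply/funext => t /=; rewrite tnth_mktuple.
Qed.

HB.instance Definition _ s := isMeasurableFun.Build _ _ _ _ (tuple_perm s) (measurable_tuple_perm s).

Definition box (A : 'I_n -> set T) : set (n.-tuple T) := [set t | forall i, A i (tnth t i)].

Lemma measurable_box (A : 'I_n -> set T) :
  (forall i, measurable (A i)) -> measurable (box A).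
Proof.
move=> mA; rewrite (_ : box A = \bigcap_(i in [set: 'I_n])
    ((fun t => tnth t i) @^-1` A i)).
  apply: fin_bigcap_measurable => // i _.
  by rewrite -[X in measurable X]setTI; exact: measurable_tnth.
by apply/seteqP; split => [t/= At i _|t/= At i]; exact: At.
Qed.

(** Both measures give a box the product of the masses of its sides, up to the order of the factors,
    and boxes form a generating family stable under intersection. *)
Lemma product_law_tuple_perm s (mu : probability T R) (A : set (n.-tuple T)) :
  measurable A ->
  distribution (product_law (fun _ : 'I_n => mu)) (tuple_perm s) A =
  product_law (fun _ : 'I_n => mu) A.
Proof.
move=> mA.
pose G := [set box B | B in [set B : 'I_n -> set T | forall i, measurable (B i)]].
apply: (@measure_unique _ _ _ G (fun=> setT)) => //.
- apply/seteqP; split.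
    apply: smallest_sub; first exact: smallest_sigma_algebra.
    move=> B; rewrite -bigcup_seq => -[i _ [Y mY]] <-; apply: sub_sigma_algebra.
    exists (fun j => if j == i then Y else setT).
      by move=> j; case: ifP => // _; exact: measurableT.
    apply/seteqP; split => t /=.
      by move=> /(_ i); rewrite eqxx.
    by move=> [_ Yt] j; case: eqP => // ->.
  apply: smallest_sub; first exact: sigma_algebra_measurable.
  by move=> _ [B mB <-]; exact: measurable_box.
- move=> _ _ [B mB <-] [C mC <-]; exists (fun i => B i `&` C i).
    by move=> i; exact: measurableI.
  apply/seteqP; split => t /=; first by move=> h; split => i; case: (h i).
  by move=> [hB hC] i; split; [exact: hB|exact: hC].
- by move=> _; exists (fun=> setT) => //; apply/seteqP; split.
- by rewrite bigcup_const.
- move=> _ [B mB <-]; rewrite /distribution /pushforward.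
  apply: (@etrans _ _ (\prod_(i < n) mu (B i))%E); last exact: esym (product_law_box (fun=> mu) mB).
  have sB : tuple_perm s @^-1` box B = box (fun i => B (s^-1%g i)).
    apply/seteqP; split => t /= h i.
      by have := h (s^-1 i)%g; rewrite tnth_mktuple permKV.
    by rewrite tnth_mktuple; have := h (s i); rewrite permK.
  apply: etrans (congr1 (product_law (fun=> mu)) sB) _.
  apply: etrans (product_law_box (fun=> mu) (fun i => mB (s^-1 i)%g)) _.
  rewrite (reindex_inj (@perm_inj _ s))/=.
  by apply: eq_bigr => i _; rewrite permK.
- by move=> k; rewrite (le_lt_trans (probability_le1 _ measurableT))// ltry.
Qed.

Lemma Rintegral_product_law_perm s (mu : probability T R) (f : n.-tuple T -> R) :
  measurable_fun setT f -> (forall t, 0 <= f t) ->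
  \int[product_law (fun _ : 'I_n => mu)]_t f (tuple_perm s t) =
  \int[product_law (fun _ : 'I_n => mu)]_t f t.
Proof.
move=> mf f0; rewrite -[LHS](Rintegral_pushforward _ (tuple_perm s))//.
rewrite /Rintegral; congr fine; apply: eq_measure_integral => A mA _.
exact: product_law_tuple_perm.
Qed.

End product_law_perm.

(** * Borel functions on the cube, read on tuples *)

Section cube.
Variables (R : realType).

Lemma compact_cube n : compact (cube R n).
Proof. by apply: (@rV_compact R n (fun=> `[0, 1]%classic)) => i; exact: segment_compact. Qed.

Lemma closed_cube n : closed (cube R n).
Proof.
have -> : cube R n = \bigcap_(i in [set: 'I_n]) [set x | x ord0 i \in `[0, 1]%R].
  by apply/seteqP; split=> [x xc i _|x xc i]; exact: xc.
apply: closed_bigI => i _.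
apply: (@preimage_closed 'rV[R]_n R (fun x : 'rV[R]_n => x ord0 i) `[0, 1]%classic).
  by move=> x _; exact: coord_continuous.
exact: interval_closed.
Qed.

Definition unit_box n : set (n.-tuple R) := [set t | forall i, tnth t i \in `[0, 1]%R].
Arguments unit_box : clear implicits.

Lemma row_of_tuple_cube n : @row_of_tuple R n @^-1` cube R n = unit_box n.
Proof. by apply/seteqP; split=> t /= tc i; have := tc i; rewrite ?mxE. Qed.

Lemma measurable_unit_box n :
  measurable (unit_box n : set (n.-tuple (measurableTypeR R))).
Proof.
rewrite (_ : unit_box n = @box _ (measurableTypeR R) n (fun=> `[0, 1]%classic))//.
apply: measurable_box => i.
exact: measurable_itv.
Qed.

(** Open sets generate the sigma-algebra of row vectors, coordinate projections that of tuples. They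
    are reconciled by writing an open set as a countable union of sup-norm balls with rational
    centre and radius [1/(m+1)], each of which is a box. *)
Lemma measurable_row_of_tuple n :
  measurable_fun setT (@row_of_tuple R n :
    n.-tuple (measurableTypeR R) -> g_sigma_algebraType (@open 'rV[R]_n)).
Proof.
apply: (@measurability _ _ _ (g_sigma_algebraType (@open 'rV[R]_n)) setT _ (@open 'rV[R]_n)) => // _ [U oU <-]; rewrite setTI.
pose q (p : {ffun 'I_n -> rat} * nat) : 'rV[R]_n := \row_i ratr (p.1 i).
pose A p : set (n.-tuple R) := [set t | ball (q p) p.2.+1%:R^-1 `<=` U /\
  forall i, `|ratr (p.1 i) - tnth t i| < p.2.+1%:R^-1].
have -> : @row_of_tuple R n @^-1` U = \bigcup_p A p.
  apply/seteqP; split=> t /=; last first.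
    move=> [p _ [pU pt]]; apply: pU; apply/ball_rowP => // i.
    by rewrite !mxE.
  move=> tU; have /nbhs_ballP[e /= e0 eU] : nbhs (row_of_tuple t) U.
    exact: open_nbhs_nbhs.
  have e2 : 0 < e / 2 by rewrite divr_gt0.
  have [N _ /(_ N (leqnn _)) /= Ne] := near_infty_natSinv_lt (PosNum e2).
  have /choice[r rt] : forall i, exists r : rat, `|ratr r - tnth t i| < N.+1%:R^-1.
    move=> i; have N0 : 0 < N.+1%:R^-1 :> R by rewrite invr_gt0.
    have tN : tnth t i - N.+1%:R^-1 < tnth t i + N.+1%:R^-1.
      by rewrite ltrBlDr -addrA ltrDl addr_gt0.
    have [r] := rat_in_itvoo tN; rewrite in_itv /= => /andP[r1 r2].
    by exists r; rewrite ltr_norml; move: r1 r2; move: (ratr r) (tnth t i : R) (_^-1 : R) => x y z; lra.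
  exists ([ffun i => r i], N) => //; split=> /=; last by move=> i; rewrite ffunE.
  move=> y bqy; have N0 : 0 < N.+1%:R^-1 :> R by rewrite invr_gt0.
  move/(ball_rowP _ _ N0) : bqy => yq; apply: eU; apply/ball_rowP => // i; have := yq i; have := rt i.
  rewrite !mxE ffunE !ltr_norml; move: Ne; move: (N.+1%:R^-1) => d.
  by move=> de /andP[? ?] /andP[? ?]; apply/andP; split; lra.
apply: countable_bigcupT_measurable; first exact: countableP.
move=> p; have [pU|pU] := pselect (ball (q p) p.2.+1%:R^-1 `<=` U); last first.
  rewrite (_ : A p = set0); first exact: measurable0.
  by apply/seteqP; split => // t [].
rewrite (_ : A p = @box _ (measurableTypeR R) n (fun i =>
    (`]ratr (p.1 i) - p.2.+1%:R^-1, ratr (p.1 i) + p.2.+1%:R^-1[%classic : set R))).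
  by apply: measurable_box => i; exact: measurable_itv.
apply/seteqP; split => t /=.
  move=> [_ h] i; have := h i; rewrite /= in_itv /= ltr_norml.
  by move: (ratr _) (tnth t i : R) (_^-1 : R) => x y z; lra.
move=> h; split => // i; have := h i; rewrite /= in_itv /= ltr_norml.
by move: (ratr _) (tnth t i : R) (_^-1 : R) => x y z; lra.
Qed.

(** Extension by 0 outside the cube: integrals then run over the whole space, and bounds and
    Tonelli's theorem apply without a domain condition. *)
Definition on_tuples n (f : 'rV[R]_n -> R) : n.-tuple (measurableTypeR R) -> R :=
  (f \o @row_of_tuple R n) \_ (unit_box n).

Lemma borel_on_tuples n (f : 'rV[R]_n -> R) :
  borel_on_cube f -> measurable_fun setT (on_tuples f).
Proof.
move=> bf; apply/(measurable_restrictT _ (@measurable_unit_box n)).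
rewrite -row_of_tuple_cube.
apply: (measurable_comp _ _ bf).
- rewrite -[cube R n]setCK; apply: measurableC; apply: sub_sigma_algebra.
  by rewrite openC; exact: closed_cube.
- by move=> _ [t tc <-].
- exact: measurable_funTS (@measurable_row_of_tuple n).
Qed.

Lemma expectedE n (f : 'rV[R]_n -> R) (F : 'I_n -> cdf01 R) :
  expected f F = \int[product_law (fun j => dF (F j))]_t on_tuples f t.
Proof. by rewrite /expected row_of_tuple_cube Rintegral_mkcond. Qed.

Lemma on_tuples_ge0 n (f : 'rV[R]_n -> R) : (forall x, cube R n x -> 0 <= f x) ->
  forall t, 0 <= on_tuples f t.
Proof.
move=> f0 t; rewrite /on_tuples patchE; case: ifPn => //; rewrite inE => tc.
by apply: f0; have := tc; rewrite -row_of_tuple_cube.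
Qed.

Lemma on_tuples_le n (f : 'rV[R]_n -> R) (M : R) : 0 <= M ->
  (forall x, cube R n x -> f x <= M) -> forall t, on_tuples f t <= M.
Proof.
move=> M0 fM t; rewrite /on_tuples patchE; case: ifPn => //; rewrite inE => tc.
by apply: fM; have := tc; rewrite -row_of_tuple_cube.
Qed.

Lemma on_tuples_perm n (s : 'S_n) (f : 'rV[R]_n -> R) t :
  on_tuples (f \o col_perm s) t = on_tuples f (tuple_perm s t).
Proof.
rewrite /on_tuples !patchE.
have -> : (tuple_perm s t \in unit_box n) = (t \in unit_box n).
  apply/idP/idP; rewrite !inE => h i; last by rewrite tnth_mktuple; exact: h.
  by have := h (s^-1 i)%g; rewrite tnth_mktuple permKV.
case: ifP => // _ /=; congr f.
by apply/rowP => i; rewrite !mxE tnth_mktuple.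
Qed.

Lemma expected_perm n (s : 'S_n) (f : 'rV[R]_n -> R) (F : cdf01 R) :
  borel_on_cube f -> (forall x, cube R n x -> 0 <= f x) ->
  expected (f \o col_perm s) (fun=> F) = expected f (fun=> F).
Proof.
move=> bf f0; rewrite !expectedE.
under eq_Rintegral do rewrite on_tuples_perm.
apply: Rintegral_product_law_perm; first exact: borel_on_tuples.
exact: on_tuples_ge0.
Qed.

End cube.

(** * Continuity of expected payoffs *)

Section clip.
Variable R : realType.
Implicit Types x y : R.

(** The truncation of [x] to [[0, 1]], written with absolute values so that continuity comes from
    that of the norm. *)
Definition clip x : R := (`|x| - `|x - 1| + 1) / 2.

Lemma clip_le0 x : x <= 0 -> clip x = 0.
Proof. by move=> x0; rewrite /clip (ler0_norm x0) ler0_norm; lra. Qed.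

Lemma clip_ge1 x : 1 <= x -> clip x = 1.
Proof. by move=> x1; rewrite /clip !ger0_norm; lra. Qed.

Lemma clip_id x : 0 <= x <= 1 -> clip x = x.
Proof.
by move=> /andP[x0 x1]; rewrite /clip (ger0_norm x0) ler0_norm; lra.
Qed.

Lemma clip_homo : nondecreasing clip.
Proof.
move=> x y xy; have [x0|x0] := leP x 0; have [y0|y0] := leP y 0;
  have [x1|x1] := leP 1 x; have [y1|y1] := leP 1 y;
  rewrite ?(clip_le0 x0) ?(clip_le0 y0) ?(clip_ge1 x1) ?(clip_ge1 y1) ?clip_id; lra.
Qed.

Lemma clip_ge0 x : 0 <= clip x.
Proof.
have [x0|x0] := leP x 0; first by rewrite clip_le0.
by rewrite -(clip_le0 (lexx 0)); apply: clip_homo; exact: ltW.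
Qed.

Lemma clip_le1 x : clip x <= 1.
Proof.
have [x1|x1] := leP 1 x; first by rewrite clip_ge1.
by rewrite -(clip_ge1 (lexx 1)); apply: clip_homo; exact: ltW.
Qed.

Lemma clip_lip x y : x <= y -> clip y - clip x <= y - x.
Proof.
move=> xy; have [x0|x0] := leP x 0; have [y0|y0] := leP y 0;
  have [x1|x1] := leP 1 x; have [y1|y1] := leP 1 y;
  rewrite ?(clip_le0 x0) ?(clip_le0 y0) ?(clip_ge1 x1) ?(clip_ge1 y1) ?clip_id; lra.
Qed.

Lemma continuous_clip : continuous clip.
Proof.
move=> x; apply: cvgMr_tmp; apply: cvgD; last exact: cvg_cst.
apply: cvgB; first exact: (@norm_continuous R R^o).
apply: (@cvg_norm R R^o); apply: cvgB; [exact: cvg_id|exact: cvg_cst].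
Qed.

End clip.

Section hat.
Variables (R : realType) (K : nat).

(* The tent functions centred at j / K form a continuous partition of unity of
   [0, 1]; as a difference of two consecutive clipped ramps, their sum
   telescopes. *)
Definition tent (j : nat) (x : R) : R :=
  clip (K%:R * x + 1 - j%:R) - clip (K%:R * x + 1 - j.+1%:R).

Definition hat j : R -> R := tent j \_ `[0, 1].

Lemma continuous_tent j : continuous (tent j).
Proof.
have c m : continuous (fun x : R => clip (K%:R * x + 1 - m%:R)).
  move=> x; apply: (@continuous_comp _ _ _ (fun x : R => K%:R * x + 1 - m%:R) (@clip R)).
    apply: cvgB; last exact: cvg_cst.
    by apply: cvgD; [apply: cvgMl_tmp; exact: cvg_id|exact: cvg_cst].
  exact: continuous_clip.
by move=> x; apply: cvgB; exact: c.
Qed.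

Lemma tent_ge0 j x : 0 <= tent j x.
Proof. by rewrite subr_ge0; apply: clip_homo; rewrite lerD2l lerN2 ler_nat. Qed.

Lemma tent_le1 j x : tent j x <= 1.
Proof. by rewrite (le_trans _ (clip_le1 (K%:R * x + 1 - j%:R)))// gerBl clip_ge0. Qed.

Lemma hat_ge0_le1 j x : 0 <= hat j x <= 1.
Proof.
by rewrite /hat patchE; case: ifP; rewrite ?tent_ge0 ?tent_le1// lexx ler01.
Qed.

Lemma hat_out j x : x \notin `[0, 1]%R -> hat j x = 0.
Proof.
by move=> x01; rewrite /hat patchE memNset//; exact/negP.
Qed.

Lemma measurable_hat j : measurable_fun setT (hat j).
Proof.
apply/(measurable_restrictT _ (@measurable_itv R `[0, 1]%R)).
apply: measurable_funTS; apply: continuous_measurable_fun.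
exact: continuous_tent.
Qed.

Lemma tent_neq0 j x : (0 < K)%N -> tent j x != 0 -> `|x - j%:R / K%:R| <= K%:R^-1.
Proof.
move=> K0; have K0' : 0 < K%:R :> R by rewrite ltr0n.
move=> tx; suff : `|K%:R * x - j%:R| <= 1.
  rewrite -(@ler_pM2l _ K%:R^-1) ?invr_gt0// mulr1; congr (_ <= _).
  rewrite -[X in X * _](@gtr0_norm _ K%:R^-1) ?invr_gt0// -normrM; congr `|_|.
  by rewrite mulrBr mulKf ?gt_eqF// mulrC.
apply: contraNT tx; rewrite -ltNge ltr_normr => /orP[h|h]; apply/eqP; rewrite /tent.
  rewrite !clip_ge1 ?subrr//; move: h; rewrite -?natr1; lra.
rewrite !clip_le0 ?subrr//; move: h; rewrite -?natr1; lra.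
Qed.

Lemma sum_hat x : x \in `[0, 1]%R -> \sum_(j < K.+1) hat j x = 1.
Proof.
move=> x01; have := x01; rewrite in_itv/= => /andP[x0 x1].
transitivity (\sum_(0 <= j < K.+1) tent j x).
  rewrite big_mkord; apply: eq_bigr => j _.
  by rewrite /hat patchE mem_set.
rewrite (telescope_sumr_eq (fun j => - clip (K%:R * x + 1 - j%:R)))//; last first.
  by move=> j _; rewrite /tent opprK addrC.
have Kx : 0 <= K%:R * x <= K%:R by rewrite mulr_ge0//= ler_piMr.
rewrite clip_le0; last by rewrite -natr1; move: Kx; lra.
by rewrite clip_ge1 ?oppr0 ?opprK ?add0r// addr0 lerDr; case/andP: Kx.
Qed.

End hat.

Section uniform_continuity.
Variables (R : realType) (n : nat) (f : 'rV[R]_n -> R).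
Hypothesis cf : {within cube R n, continuous f}.

(** Heine's theorem: otherwise pairs at distance at most [1/(N+1)] violate the bound for all [N],
    and continuity fails at a cluster point of their first components. *)
Lemma cube_uniform_continuous (e : R) : 0 < e -> exists2 d, 0 < d &
  forall x y, cube R n x -> cube R n y ->
    (forall i, `|x ord0 i - y ord0 i| <= d) -> `|f x - f y| <= e.
Proof.
move=> e0; apply: contrapT => /forall2NP no.
have h N : exists p : 'rV[R]_n * 'rV[R]_n, [/\ cube R n p.1, cube R n p.2,
    forall i, `|p.1 ord0 i - p.2 ord0 i| <= N.+1%:R^-1 & e < `|f p.1 - f p.2|].
  have [/negP|/existsNP[x /existsNP[y]]] := no N.+1%:R^-1.
    by rewrite invr_gt0 ltr0n.
  do 3 move=> /not_implyP[?]; move=> /negP; rewrite -ltNge => ?.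
  by exists (x, y).
have [p pP] := choice h.
have [z [zc zp]] : cube R n `&` cluster ((fst \o p) @ \oo) !=set0.
  apply: compact_cube; exists 0%N => // N _ /=.
  by have [] := pP N.
have e2 : 0 < e / 2 by rewrite divr_gt0.
have /subspace_continuousP/(_ z zc)/cvgrPdist_lt/(_ _ e2) nb := cf.
have {nb} /nbhs_ballP[d /= d0 dP] : nbhs z (fun t => cube R n t -> `|f z - f t| < e / 2).
  exact: nb.
have d2 : 0 < d / 2 by rewrite divr_gt0.
have [N [Nd zpN]] : exists N, N.+1%:R^-1 < d / 2 /\ ball z (d / 2) (p N).1.
  have [] := zp ((fst \o p) @` [set N | N.+1%:R^-1 < d / 2]) (ball z (d / 2)).
  - have := near_infty_natSinv_lt (PosNum d2); apply: filterS => N /= Nd.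
    by exists N.
  - exact: nbhsx_ballx.
  - by move=> _ [[N kN <-] zN]; exists N.
have [p1 p2 p12] := pP N; apply/negP; rewrite -leNgt.
move/(ball_rowP _ _ d2) in zpN.
have h1 : `|f z - f (p N).1| < e / 2.
  apply: dP => //; apply/ball_rowP => // i.
  by apply: lt_le_trans (zpN i) _; move: d0; lra.
have h2 : `|f z - f (p N).2| < e / 2.
  apply: dP => //; apply/ball_rowP => // i; have := zpN i; have := p12 i; move: Nd.
  rewrite ler_norml !ltr_norml; move: (N.+1%:R^-1) => r.
  by move=> ? /andP[? ?] /andP[? ?]; apply/andP; split; lra.
move: h1 h2; rewrite !ltr_norml => /andP[? ?] /andP[? ?].
by rewrite ler_norml; apply/andP; split; lra.
Qed.

End uniform_continuity.

Lemma cvg_prodr (R : numFieldType) (T : Type)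
    (F : set_system T) (I : Type) (r : seq I) (P : pred I) (f : I -> T -> R)
    (a : I -> R) : Filter F ->
  (forall i, P i -> f i x @[x --> F] --> a i) ->
  (\prod_(i <- r | P i) f i x) @[x --> F] --> \prod_(i <- r | P i) a i.
Proof. by move=> FF; exact: (cvg_big mul_continuous). Qed.

Section weak_continuity.
Variable R : realType.

Lemma continuous_integral (f : R -> R) : {within `[0, 1], continuous f} ->
  continuous (fun F : cdf01 R => \int[dF F]_(x in `[0, 1]) f x).
Proof.
move=> cf F; have /weak_cvgP : nbhs F --> F by exact: cvg_id.
exact.
Qed.

Section expected_continuous.
Variables (n : nat) (f : 'rV[R]_n -> R) (M : R).
Hypotheses (cf : {within cube R n, continuous f}) (bf : measurable_fun setT (on_tuples f))
  (f0M : forall x, cube R n x -> 0 <= f x <= M).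

Let M0 : 0 <= M.
Proof.
have /f0M/andP[h1 h2] : cube R n 0.
  by move=> i; rewrite mxE in_itv/= lexx ler01.
exact: le_trans h2.
Qed.

Let node K (J : {ffun 'I_n -> 'I_K.+1}) : 'rV[R]_n := \row_i ((J i)%:R / K%:R).

Let cube_node K J : (0 < K)%N -> cube R n (@node K J).
Proof.
move=> K0 i; rewrite mxE in_itv/= divr_ge0//= ler_pdivrMr ?ltr0n// mul1r ler_nat.
by rewrite -ltnS.
Qed.

Let interpolant K (t : n.-tuple (measurableTypeR R)) : R :=
  \sum_(J : {ffun 'I_n -> 'I_K.+1}) f (node J) * \prod_i hat K (J i) (tnth t i).

Let hats_ge0_le1 K (J : {ffun 'I_n -> 'I_K.+1}) (t : n.-tuple (measurableTypeR R)) :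
  0 <= \prod_i hat K (J i) (tnth t i) <= 1.
Proof.
apply/andP; split.
  by apply: prodr_ge0 => i _; case/andP: (hat_ge0_le1 K (J i) (tnth t i)).
by apply: Num.Theory.prodr_ile1 => i _; exact: hat_ge0_le1.
Qed.

Let measurable_hats K (J : {ffun 'I_n -> 'I_K.+1}) :
  measurable_fun setT (fun t : n.-tuple (measurableTypeR R) => \prod_i hat K (J i) (tnth t i)).
Proof.
apply: measurable_prod => i _; apply: measurableT_comp; last exact: measurable_tnth.
exact: measurable_hat.
Qed.

Let sum_hats K (t : n.-tuple (measurableTypeR R)) : @unit_box R n t ->
  \sum_(J : {ffun 'I_n -> 'I_K.+1}) \prod_i hat K (J i) (tnth t i) = 1.
Proof.
move=> tb; rewrite -(bigA_distr_bigA (fun i (j : 'I_K.+1) => hat K j (tnth t i))).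
by rewrite big1// => i _; rewrite sum_hat//; exact: tb.
Qed.

Let interpolant_close e : 0 < e -> exists2 K, (0 < K)%N &
  forall t, `|on_tuples f t - interpolant K t| <= e.
Proof.
move=> e0; have [d d0 fd] := cube_uniform_continuous cf e0.
have [N _ /(_ N (leqnn _)) /= Nd] := near_infty_natSinv_lt (PosNum d0).
exists N.+1 => // t; rewrite /on_tuples patchE.
have [|] := boolP (t \in _); rewrite ?notin_setE ?inE => tb; last first.
  rewrite /interpolant big1 ?subrr ?normr0 ?ltW// => J _.
  have /existsNP[i /negP ti] : ~ forall i, tnth t i \in `[0, 1]%R by [].
  by rewrite (bigD1 i)//= hat_out// mul0r mulr0.
pose w (J : {ffun 'I_n -> 'I_N.+2}) := \prod_i hat N.+1 (J i) (tnth t i).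
have w1 : \sum_J w J = 1 := sum_hats N.+1 tb.
have -> : (f \o row_of_tuple (n:=n)) t = \sum_J f (row_of_tuple t) * w J.
  by rewrite -mulr_sumr w1 mulr1.
rewrite /interpolant -sumrB; apply: le_trans (ler_norm_sum _ _ _) _.
rewrite -[leRHS]mulr1 -[X in _ <= _ * X]w1 mulr_sumr; apply: ler_sum => J _.
have /andP[h0 h1] := hats_ge0_le1 J t.
rewrite -[X in _ - _ * X]/(w J) -mulrBl normrM (@ger0_norm _ (w J) h0).
(* A node with nonzero weight is within [1/K] of the point in every coordinate, so uniform
   continuity bounds each term that counts. *)
have [->|hJ] := eqVneq (w J) 0; first by rewrite !mulr0.
rewrite ler_wpM2r//; apply: fd.
- by rewrite -[cube R n _]/((@row_of_tuple R n @^-1` cube R n) t) row_of_tuple_cube.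
- exact: cube_node.
move=> i; rewrite !mxE; apply: le_trans (ltW Nd).
apply: tent_neq0 => //; apply: contraNneq hJ => tJ.
by rewrite /w (bigD1 i)//= /hat patchE; case: ifP => _; rewrite ?tJ mul0r.
Qed.

Let expected_interpolant K (F : cdf01 R) :
  \int[product_law (fun _ : 'I_n => dF F)]_t interpolant K t =
  \sum_(J : {ffun 'I_n -> 'I_K.+1})
    f (node J) * \prod_i \int[dF F]_(x in `[0, 1]) tent K (J i) x.
Proof.
rewrite (@Rintegral_prob_sum _ _ _ _ _ _ _ (fun J => `|f (node J)|)); last 2 first.
- by move=> J; apply: measurable_funM => //; exact: measurable_cst.
- move=> J t; have /andP[h0 h1] := hats_ge0_le1 J t.
  by rewrite normrM (ger0_norm h0) ler_piMr.
apply: eq_bigr => J _; rewrite RintegralZl//; last first.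
  apply: (@bounded_integrable _ _ _ _ _ 1) => [|t]; first exact: measurable_hats.
  by have /andP[h0 h1] := hats_ge0_le1 J t; rewrite ger0_norm.
congr (_ * _).
rewrite (@product_law_prod _ (measurableTypeR R) R n (fun=> dF F) (fun i => hat K (J i))).
- by apply: eq_bigr => i _; rewrite [RHS]Rintegral_mkcond.
- by move=> i; exact: measurable_hat.
- by move=> i x; exact: hat_ge0_le1.
Qed.

Let bounded_on_tuples t : `|on_tuples f t| <= M.
Proof.
rewrite ger0_norm; first by apply: on_tuples_le => // x /f0M/andP[].
by apply: on_tuples_ge0 => x /f0M/andP[].
Qed.

Let norm_chain (a b a' b' e : R) : `|a - b| <= e / 3 -> `|a' - b'| <= e / 3 ->
  `|b - b'| <= e / 3 -> `|a - a'| <= e.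
Proof.
rewrite !ler_norml => /andP[? ?] /andP[? ?] /andP[? ?].
by apply/andP; split; lra.
Qed.

(** Independence makes the expectation of the interpolant a polynomial in the integrals of the
    tents, each weakly continuous by the choice of the topology. The interpolation error is uniform
    on the cube, hence uniform over all laws, and a limit of this kind stays continuous. *)
Lemma expected_continuous :
  continuous (fun F : cdf01 R => expected f (fun=> F)).
Proof.
move=> F; have FF : Filter (nbhs F) := nbhs_filter F.
apply/cvgrPdist_le => e e0.
have e3 : 0 < e / 3 by rewrite divr_gt0.
have [K K0 fK] := interpolant_close e3.
have close (G : cdf01 R) : `|expected f (fun=> G) -
    \int[product_law (fun _ : 'I_n => dF G)]_t interpolant K t| <= e / 3.
  rewrite expectedE; apply: (@Rintegral_prob_distB _ _ _ _ _ _ M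
    (\sum_(J : {ffun 'I_n -> 'I_K.+1}) `|f (node J)|)) => //.
  - apply: measurable_sum => J; apply: measurable_funM => //; exact: measurable_cst.
  - move=> t; apply: le_trans (ler_norm_sum _ _ _) _; apply: ler_sum => J _.
    have /andP[h0 h1] := hats_ge0_le1 J t.
    by rewrite normrM (ger0_norm h0) ler_piMr.
have : (fun G : cdf01 R => \int[product_law (fun _ : 'I_n => dF G)]_t interpolant K t)
    @ F --> \int[product_law (fun _ : 'I_n => dF F)]_t interpolant K t.
  rewrite expected_interpolant; under eq_fun do rewrite expected_interpolant.
  apply: cvg_sumr => J _; apply: cvgMl_tmp; apply: cvg_prodr => i _.
  by apply: continuous_integral; apply: continuous_subspaceT; exact: continuous_tent.
move=> /cvgrPdist_le/(_ _ e3); apply: filterS => G FG.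
exact: norm_chain (close F) (close G) FG.
Qed.

End expected_continuous.
End weak_continuity.

(** * Weak compactness of the set of cdfs *)

Section levy.
Variable R : realType.
Implicit Types F G : cdf01 R.

Lemma cdf01_homo F : nondecreasing F.
Proof. exact: cumulative_is_nondecreasing. Qed.

Lemma cdf01_ge0 F x : 0 <= F x.
Proof.
apply: (@le_trans _ _ (F (Num.min x (-1)))).
  by rewrite cdf01_lt0// gt_min ltrN10 orbT.
by apply: cdf01_homo; rewrite ge_min lexx.
Qed.

Lemma cdf01_le1 F x : F x <= 1.
Proof.
apply: (@le_trans _ _ (F (Num.max x 1))).
  by apply: cdf01_homo; rewrite le_max lexx.
by rewrite cdf01_ge1// le_max lexx orbT.
Qed.

Lemma Rintegral_indic_itv F (x : R) : 0 <= x ->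
  \int[dF F]_y \1_`[0, x] y = F x.
Proof. by move=> x0; rewrite /Rintegral integral_indic//= setIT dF_itv. Qed.

Section step.
Variables (f : R -> R) (K : nat).

Definition node j : R := j%:R / K%:R.

(** On [[0, 1]] the value is [f] at the first node at or above [x]. The Abel-summed form uses only
    intervals [[0, b]], so its integral is a combination of values of the cdf at the nodes. *)
Definition step (x : R) : R := f 1 * \1_`[0, 1] x -
  \sum_(j < K) (f (node j.+1) - f (node j)) * \1_`[0, node j] x.

Let measurable_Zindic (r b : R) :
  measurable_fun setT (fun x : R => r * \1_`[0, b] x).
Proof. by apply: measurable_funM; [exact: measurable_cst|exact: measurable_indic]. Qed.

Let Zindic_le (r b x : R) : `|r * \1_`[0, b] x| <= `|r|.
Proof.
by rewrite normrM ler_piMr// indicE; case: (_ \in _); rewrite ?normr1 ?normr0.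
Qed.

Let integrable_indic F b :
  (dF F).-integrable setT (EFin \o (fun x => \1_`[0, b] x : R)).
Proof.
apply: (@bounded_integrable _ _ _ _ _ 1); first exact: measurable_indic.
by move=> x; rewrite indicE; case: (_ \in _); rewrite ?normr1 ?normr0.
Qed.

Lemma measurable_step : measurable_fun setT step.
Proof.
apply: measurable_realfun.measurable_funB; first exact: measurable_Zindic.
by apply: measurable_sum => j; exact: measurable_Zindic.
Qed.

Lemma step_bounded x : `|step x| <=
  `|f 1| + \sum_(j < K) `|f (node j.+1) - f (node j)|.
Proof.
apply: le_trans (ler_normB _ _) _; apply: lerD => //.
by apply: le_trans (ler_norm_sum _ _ _) _; apply: ler_sum => j _.
Qed.

Lemma node_itv j : (j <= K)%N -> 0 <= node j <= 1.
Proof.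
move=> jK; have [K0|K0] := posnP K.
  by move: jK; rewrite K0 leqn0 => /eqP->; rewrite /node mul0r lexx ler01.
by rewrite divr_ge0//= ler_pdivrMr ?ltr0n// mul1r ler_nat.
Qed.

Lemma Rintegral_step F : \int[dF F]_x step x =
  f 1 - \sum_(j < K) (f (node j.+1) - f (node j)) * F (node j).
Proof.
rewrite RintegralB//; last 2 first.
- apply: (@bounded_integrable _ _ _ _ _ `|f 1|) => [|x].
    exact: measurable_Zindic.
  exact: Zindic_le.
- apply: (@bounded_integrable _ _ _ _ _ (\sum_(j < K) `|f (node j.+1) - f (node j)|)).
    by apply: measurable_sum => j; exact: measurable_Zindic.
  by move=> x; apply: le_trans (ler_norm_sum _ _ _) _; apply: ler_sum => j _.
rewrite RintegralZl//; last exact: integrable_indic.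
rewrite Rintegral_indic_itv// cdf01_ge1// mulr1; congr (_ - _).
rewrite (@Rintegral_prob_sum _ _ _ _ _ _ _ (fun j : 'I_K => `|f (node j.+1) - f (node j)|)); last 2 first.
- by move=> j; exact: measurable_Zindic.
- by move=> j x; exact: Zindic_le.
apply: eq_bigr => j _; rewrite RintegralZl//; last exact: integrable_indic.
rewrite Rintegral_indic_itv//.
by case/andP: (node_itv (ltnW (ltn_ord j))).
Qed.

Lemma step_close e : (0 < K)%N ->
  (forall x y, x \in `[0, 1]%R -> y \in `[0, 1]%R -> `|x - y| <= K%:R^-1 ->
    `|f x - f y| <= e) ->
  forall x, x \in `[0, 1]%R -> `|f x - step x| <= e.
Proof.
move=> K0 fe x x01; have := x01; rewrite in_itv/= => /andP[x0 x1].
have K0' : 0 < K%:R :> R by rewrite ltr0n.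
have ex : exists i, x <= node i by exists K; rewrite /node divff ?gt_eqF.
have [i xi imin] := ex_minnP ex.
have iK : (i <= K)%N by apply: imin; rewrite /node divff ?gt_eqF.
have -> : step x = f (node i).
  rewrite /step -(big_mkord xpredT (fun j => (f (node j.+1) - f (node j)) * \1_`[0, node j] x)).
  rewrite indicE mem_set// mulr1 (@big_cat_nat _ _ _ i)//= big_nat big1 ?add0r; last first.
    move=> j /andP[_ ji]; rewrite indicE memNset ?mulr0//=.
    by rewrite in_itv/= x0 => /imin; rewrite leqNgt ji.
  rewrite (telescope_sumr_eq (f \o node))//=.
    by rewrite [node K]/node divff ?gt_eqF// subKr.
  move=> j /andP[ij jK]; rewrite indicE mem_set ?mulr1//= in_itv/= x0.
  by rewrite (le_trans xi)// ler_pM2r ?invr_gt0// ler_nat.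
apply: fe => //; first by rewrite in_itv/= node_itv.
rewrite ler_norml; move: xi imin; case: i iK => [|i] iK xi imin.
  have -> : x = 0 by apply/eqP; rewrite eq_le x0 andbT; move: xi; rewrite /node mul0r.
  by rewrite /node mul0r subr0 oppr_le0 invr_ge0 ltW.
have : node i < x by rewrite ltNge; apply/negP => /imin; rewrite ltnn.
move: xi; have -> : node i.+1 = node i + K%:R^-1 by rewrite /node -natr1 mulrDl mul1r.
have : 0 < K%:R^-1 :> R by rewrite invr_gt0.
by move: (node i) (K%:R^-1) => a b; lra.
Qed.

End step.

Let norm_chain (a b c d r : R) : `|a - b| <= r -> `|c - d| <= r ->
  `|b - d| <= 3 * r -> `|a - c| <= 5 * r.
Proof.
rewrite !ler_norml => /andP[? ?] /andP[? ?] /andP[? ?].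
by apply/andP; split; lra.
Qed.

(** A criterion of Lévy type; the shift from [x] to [y] replaces the restriction to continuity
    points. After discretization, the small increments of [f] multiply the errors of the cdf at the
    nodes. These errors are at most nearby increments of [G] plus [1/K], and their sum stays bounded
    however fine the mesh is. *)
Lemma weak_cvg_levy (S : set_system (cdf01 R)) (G : cdf01 R) : Filter S ->
  (forall x y e : R, x < y -> 0 < e ->
    S [set F : cdf01 R | G x - e <= F y /\ F x <= G y + e]) ->
  S --> G.
Proof.
move=> FS SG; apply/weak_cvgP => f cf; apply/cvgrPdist_le => e e0.
(* One fifth for each of the two step approximations, three fifths for comparing the integrals of
   the step function. *)
have e5 : 0 < e / 5 by rewrite divr_gt0.
have cf1 : {within cube R 1, continuous (fun x : 'rV[R]_1 => f (x ord0 ord0))}.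
  apply/subspace_continuousP => x xc A fA.
  have /subspace_continuousP/(_ _ (xc ord0))/(_ A fA) cfx := cf.
  have := @coord_continuous R 1 1 ord0 ord0 x _ cfx.
  by apply: (@filterS _ _ (nbhs_filter x)) => y /= yA yc; apply: yA; exact: yc.
have [d d0 fd] := cube_uniform_continuous cf1 e5.
have [N _ /(_ N (leqnn _)) /= Nd] := near_infty_natSinv_lt (PosNum d0).
pose K := N.+1.
have K0 : 0 < K%:R^-1 :> R by rewrite invr_gt0.
have fK x y : x \in `[0, 1]%R -> y \in `[0, 1]%R -> `|x - y| <= K%:R^-1 ->
    `|f x - f y| <= e / 5.
  move=> x01 y01 xy; have := fd (\row__ x) (\row__ y); rewrite !mxE; apply.
  - by move=> i; rewrite mxE.
  - by move=> i; rewrite mxE.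
  - by move=> i; rewrite !mxE (le_trans xy)// ltW.
have close F : `|\int[dF F]_(x in `[0, 1]) f x - \int[dF F]_x step f K x| <= e / 5.
  rewrite [X in `|X - _|]Rintegral_mkcond.
  have fs x : `|(f \_ `[0, 1]) x - step f K x| <= e / 5.
    rewrite patchE; case: ifPn => [|]; rewrite ?notin_setE ?inE => x01.
      exact: step_close.
    suff -> : step f K x = 0 by rewrite subr0 normr0 ltW.
    have out b : b <= 1 -> \1_`[0, b] x = 0 :> R.
      move=> b1; rewrite indicE memNset//= => xb; apply: x01; move: xb => /=.
      by rewrite !in_itv/= => /andP[-> /le_trans]; apply.
    rewrite /step out// mulr0 big1 ?subr0// => j _; rewrite out ?mulr0//.
    by case/andP: (@node_itv K j (ltnW (ltn_ord j))).
  pose B := `|f 1| + \sum_(j < K) `|f (node K j.+1) - f (node K j)|.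
  apply: (@Rintegral_prob_distB _ (measurableTypeR R) R (dF F) (f \_ `[0, 1])
    (step f K) (e / 5 + B) B (e / 5)) => //.
  - apply/(measurable_restrictT _ (@measurable_itv R `[0, 1]%R)).
    by apply: subspace_continuous_measurable_fun => //; exact: measurable_itv.
  - move=> x; rewrite -[X in `|X|](subrK (step f K x)).
    apply: le_trans (ler_normD _ _) _.
    by apply: lerD; [exact: fs|exact: step_bounded].
  - exact: measurable_step.
  - exact: step_bounded.
have : S [set F : cdf01 R | forall j : 'I_K, `|G (node K j) - F (node K j)| <=
    G (node K j.+1) - G (node K j - K%:R^-1) + K%:R^-1].
  apply: filter_forall => j.
  have lt1 : node K j - K%:R^-1 < node K j by rewrite ltrBlDr ltrDl.
  have lt2 : node K j < node K j.+1 by rewrite ltr_pM2r// ltr_nat.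
  have := cdf01_homo G (ltW lt1); have := cdf01_homo G (ltW lt2).
  move=> G1 G2.
  apply: filterS2 (SG _ _ _ lt1 K0) (SG _ _ _ lt2 K0) => F [h1 _] [_ h2].
  by move: h1 h2 G1 G2; rewrite ler_norml; lra.
apply: filterS => F FG.
have GF : `|\int[dF G]_x step f K x - \int[dF F]_x step f K x| <= 3 * (e / 5).
  rewrite !Rintegral_step opprB addrC addrA subrK -sumrB.
  apply: le_trans (ler_norm_sum _ _ _) _.
  (* The index is shifted by one to include the node at [-1/K]. The two-step increments telescope to
     [h K.+1 + h K - h 1 - h 0 <= 2], and the [K] terms [1/K] contribute 1, whence the factor 3. *)
  pose h m := G ((m%:R - 1) / K%:R).
  have hG j : G (node K j.+1) - G (node K j - K%:R^-1) = h j.+2 - h j.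
    rewrite /h /node; congr (G (_ / _) - G _); first by rewrite -[j.+2%:R]natr1 addrK.
    by rewrite mulrBl mul1r.
  apply: (@le_trans _ _ (\sum_(j < K) e / 5 * (h j.+2 - h j + K%:R^-1))).
    apply: ler_sum => j _; rewrite -mulrBr normrM distrC -hG; apply: ler_pM => //.
      apply: fK; rewrite ?in_itv/= ?node_itv//; first exact: ltnW.
      have -> : node K j.+1 = node K j + K%:R^-1.
        by rewrite /node -[j.+1%:R]natr1 mulrDl mul1r.
      by rewrite opprD addrA subrr sub0r normrN ger0_norm// ltW.
    by rewrite distrC; exact: FG.
  rewrite -mulr_sumr mulrC ler_pM2r// big_split /= sumr_const card_ord -[X in _ + X]mulr_natr.
  rewrite mulVf ?gt_eqF// -(big_mkord xpredT (fun j => h j.+2 - h j)).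
  rewrite (telescope_sumr_eq (fun j => h j.+1 + h j))//; last first.
    by move=> j _; lra.
  have hge m : 0 <= h m by exact: cdf01_ge0.
  have hle m : h m <= 1 by exact: cdf01_le1.
  by have := hge 0%N; have := hge 1%N; have := hle K; have := hle K.+1; lra.
by have := norm_chain (close G) (close F) GF; rewrite mulrC divfK.
Qed.

(** Helly's selection theorem, with an ultrafilter in place of the diagonal subsequence. *)
Lemma compact_cdf01 : compact [set: cdf01 R].
Proof.
rewrite compact_ultra => U UU _.
have PU : ProperFilter U := ultra_proper.
(* The infimum of [E x] is the right limit at [x] of the pointwise limit of the cdfs along [U]. The
   strict inequality [x < y] is what makes [g] right-continuous. *)
pose E x := [set c | exists2 y, x < y & U [set F | F y <= c]].
pose g x := inf (E x).
have E0 x : lbound (E x) 0.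
  move=> c [y xy /filter_ex[F /=]]; apply: le_trans; exact: cdf01_ge0.
have E1 x : E x 1.
  exists (x + 1); first by rewrite ltrDl.
  by apply: filterE => F /=; exact: cdf01_le1.
have Einf x : has_inf (E x) by split; [exists 1|exists 0].
have gle x y c : x < y -> U [set F | F y <= c] -> g x <= c.
  by move=> xy Uc; apply: ge_inf; [exists 0|exists y].
have g_nd : nondecreasing g.
  move=> x y xy; apply: lb_le_inf; first by exists 1.
  by move=> c [z yz Uc]; apply: gle Uc; exact: le_lt_trans yz.
have g_rc : right_continuous g.
  move=> x; apply/cvgrPdist_le => e e0.
  have [c [y xy Uc] cg] := inf_adherent e0 (Einf x).
  near=> z.
  have xz : x < z by near: z; exact: nbhs_right_gt.
  have zy : z < y by near: z; exact: nbhs_right_lt.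
  rewrite ler_norml; apply/andP; split.
    rewrite lerNl opprB lerBlDl; apply: le_trans (ltW cg).
    exact: gle Uc.
  rewrite lerBlDr (le_trans (g_nd _ _ (ltW xz)))// lerDr ltW//.
have g_lt0 x : x < 0 -> g x = 0.
  move=> x0; apply/eqP; rewrite eq_le; apply/andP; split.
    apply: (@gle _ (x / 2)); first by lra.
    by apply: filterE => F /=; rewrite cdf01_lt0//; lra.
  by apply: lb_le_inf; first by exists 1.
have g_ge1 x : 1 <= x -> g x = 1.
  move=> x1; apply/eqP; rewrite eq_le; apply/andP; split.
    by apply: ge_inf => //; exists 0.
  apply: lb_le_inf; first by exists 1.
  move=> c [y xy /filter_ex[F /=]]; rewrite cdf01_ge1//.
  by rewrite (le_trans x1)// ltW.
exists (cdf01_of_function g_nd g_rc g_lt0 g_ge1); split => //.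
apply: weak_cvg_levy => x y e xy e0 /=.
(* If this set were not in [U], its complement would be, and [g x - e] would bound [g x] from
   above. *)
have lo : U [set F : cdf01 R | g x - e <= F y].
  have [//|UC] := in_ultra_setVsetC [set F : cdf01 R | g x - e <= F y] UU.
  have : g x <= g x - e.
    apply: (gle _ _ _ xy); apply: filterS UC => F /= /negP.
    by rewrite -ltNge => /ltW.
  by move=> h; exfalso; move: h; lra.
have [c [z yz Uc] cg] := inf_adherent e0 (Einf y).
apply: filterS2 lo Uc => F /= h1 h2; split => //.
apply: (@le_trans _ _ (F z)); first by apply: cdf01_homo; lra.
by rewrite (le_trans h2)// ltW.
Unshelve. all: by end_near. Qed.

End levy.

(** * Mixtures and stochastic dominance *)

Section dF_theory.
Variable R : realType.
Implicit Types F G H : cdf01 R.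

Lemma dF_ray F (r : R) : dF F `]-oo, r]%classic = (F r)%:E.
Proof. by rewrite -(cdf_lebesgue_stieltjes_id F r). Qed.

Lemma dF_itv_oc F (a b : R) : a <= b -> dF F `]a, b]%classic = (F b - F a)%:E.
Proof.
move=> ab; have -> : `]a, b]%classic = `]-oo, b] `\` `]-oo, a] :> set R.
  by rewrite -[RHS]setCK setCD setCitvl setUC -[LHS]setCK setCitv.
rewrite measureD//; last by apply: le_lt_trans (probability_le1 (dF F) _) (ltry _).
rewrite setIidr; last exact: subset_itvl.
exact: (congr2 (fun x y => x - y)%E (dF_ray F b) (dF_ray F a)).
Qed.

Lemma dF_lipschitz F (L x : R) : 0 <= L ->
  (forall a b, a <= b -> F b - F a <= L * (b - a)) -> dF F [set x] = 0%:E.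
Proof.
move=> L0 FL; apply/eqP; rewrite eq_le measure_ge0 andbT.
apply/lee_addgt0Pr => e e0; rewrite add0e.
have L1 : 0 < L + 1 by lra.
pose h := e / (L + 1).
have h0 : 0 < h by rewrite divr_gt0.
apply: (@le_trans _ _ (dF F `]x - h, x]%classic)).
  apply: le_measure; rewrite ?inE//.
  by move=> _ ->; rewrite /= in_itv/= lexx andbT ltrBlDr ltrDl.
have xh : x - h <= x by rewrite gerBl ltW.
rewrite dF_itv_oc// lee_fin; apply: le_trans (FL _ _ xh) _.
have L11 : L / (L + 1) <= 1 by rewrite ler_pdivrMr// mul1r lerDl.
by rewrite opprB addrC subrK /h mulrCA ler_piMr// ltW.
Qed.

Section mixtures.
Variables (k : nat) (a : 'I_k.+1 -> R) (H : 'I_k.+1 -> cdf01 R) (F : cdf01 R).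
Hypotheses (a0 : forall j, 0 <= a j) (FE : forall x, F x = \sum_j a j * H j x).

Let w (j : nat) : {nonneg R} := NngNum (a0 (inord j)).
Let m := msum (fun j => mscale (w j) (dF (H (inord j)))) k.+1.

Let dF_msum A : measurable A -> dF F A = m A.
Proof.
move=> mA; apply: lebesgue_stieltjes_measure_unique => // I [[u v]] /= _ <-.
have [uv|vu] := leP u v; last first.
  by rewrite set_itv_ge ?measure0// bnd_simp -leNgt ltW.
rewrite [LHS](dF_itv_oc F uv) !FE -sumrB /m /msum -sumEFin; apply: eq_bigr => j _.
rewrite -mulrBr EFinM -(dF_itv_oc _ uv) /mscale /=.
congr (_ * _)%E; first by rewrite /w /= inord_val.
by rewrite inord_val.
Qed.

Let Rintegral_mixture_ge0 (g : R -> R) (M : R) :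
  measurable_fun setT g -> (forall x, 0 <= g x <= M) ->
  \int[dF F]_x g x = \sum_j a j * \int[dF (H j)]_x g x.
Proof.
move=> mg gM.
have gb x : `|g x| <= M by have /andP[? ?] := gM x; rewrite ger0_norm.
have mgE : measurable_fun setT (EFin \o g) by exact/measurable_EFinP.
have g0 x : (0 <= (g x)%:E)%E by rewrite lee_fin; case/andP: (gM x).
apply: EFin_inj; rewrite -sumEFin (EFin_Rintegral (dF F) mg gb).
rewrite (eq_measure_integral m) => [|A mA _]; last exact: dF_msum.
rewrite ge0_integral_measure_sum//; apply: eq_bigr => j _.
rewrite ge0_integral_mscale// inord_val.
rewrite EFinM; congr (_ * _)%E; first by rewrite /w /= inord_val.
exact/esym/(EFin_Rintegral (dF (H j)) mg gb).
Qed.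

(** Both sides come from measures that agree on half-open intervals, hence everywhere. Only the
    values of [F] are constrained, so one cdf may be decomposed in several ways. *)
Lemma Rintegral_mixture (g : R -> R) (M : R) :
  measurable_fun setT g -> (forall x, `|g x| <= M) ->
  \int[dF F]_x g x = \sum_j a j * \int[dF (H j)]_x g x.
Proof.
move=> mg gM.
(* Adding [M] makes the integrand nonnegative. The constant cancels because the weights sum to 1, as
   seen by evaluating [FE] at 1. *)
have shift G : \int[dF G]_x (g x + M) = \int[dF G]_x g x + M.
  rewrite RintegralD//; first by rewrite Rintegral_prob_cst.
    exact: (@bounded_integrable _ (measurableTypeR R) R (dF G) g M).
  by apply: (@bounded_integrable _ _ _ _ _ `|M|).
have suma : \sum_j a j = 1.
  rewrite -(cdf01_ge1 F (lexx 1)) FE; apply: eq_bigr => j _.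
  by rewrite cdf01_ge1// mulr1.
apply: (@addIr _ M); rewrite -shift (@Rintegral_mixture_ge0 _ (M + M)).
- under eq_bigr do rewrite shift mulrDr.
  by rewrite big_split/= -mulr_suml suma mul1r.
- by apply: measurable_funD => //; exact: measurable_cst.
- by move=> x; move: (gM x); rewrite ler_norml; lra.
Qed.

End mixtures.

Section dominance.
Variables (H G : cdf01 R) (a : R) (psi : R -> R) (M : R).
Hypotheses (a0 : 0 <= a) (GH : forall x, G x <= H x + a)
  (mpsi : measurable_fun (setT : set (measurableTypeR R)) psi) (psi0M : forall x, 0 <= psi x <= M)
  (psi_homo : forall x y, 0 <= x -> x <= y -> y <= 1 -> psi x <= psi y)
  (psi_out : forall x, x \notin `[0, 1]%R -> psi x = 0).

Let dF_itv_co (t : R) : (dF G `[0%R, t[%classic <= dF H `[0%R, t[%classic + a%:E)%E.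
Proof.
pose A n : set R := `[0, t - n.+1%:R^-1]%classic.
have AE : `[0, t[%classic = \bigcup_n A n.
  apply/seteqP; split => [y|y [n _]]; rewrite /A /= !in_itv/= => /andP[y0 yt].
    have /ltr_add_invr[k] : 0 < t - y by rewrite subr_gt0.
    by rewrite add0r => ky; exists k => //=; rewrite in_itv/= y0/= lerBrDr -lerBrDl ltW// ltrBrDl.
  by rewrite y0 (le_lt_trans yt)// ltrBlDr ltrDl.
have mA n : measurable (A n : set (measurableTypeR R)) by exact: measurable_itv.
have cG : dF G \o A @ \oo --> dF G `[0, t[%classic.
  rewrite AE; apply: nondecreasing_cvg_mu => //.
    by apply: bigcup_measurable => n _.
  move=> n m nm; apply/subsetPset => y; rewrite /A /= !in_itv/= => /andP[->].
  by move=> /le_trans; apply; rewrite lerD2l lerN2 lef_pV2 ?posrE// ler_nat.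
rewrite -(cvg_lim _ cG)//; apply: lime_le; first by apply/cvg_ex; eexists; exact: cG.
apply: nearW => n /=; have [An0|An0] := ltP (t - n.+1%:R^-1) 0.
  rewrite /A set_itv_ge ?bnd_simp -?ltNge// measure0.
  by apply: adde_ge0; [exact: measure_ge0|rewrite lee_fin].
rewrite /A dF_itv// (le_trans (_ : _ <= (H (t - n.+1%:R^-1) + a)%:E)%E) ?lee_fin//.
rewrite EFinD -dF_itv// leeD2r//; apply: le_measure; rewrite ?inE; [exact: measurable_itv..|].
move=> y /=; rewrite !in_itv/= => /andP[-> /le_lt_trans]; apply.
by rewrite ltrBlDr ltrDl.
Qed.

Let U r : set R := psi @^-1` `]r, +oo[%classic.

Let measurable_U r : measurable (U r : set (measurableTypeR R)).
Proof. by rewrite -[U r]setTI; apply: mpsi => //; exact: measurable_itv. Qed.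

(** Since [psi] is monotone, the complement of a superlevel set in [[0, 1]] is an initial segment,
    so it is [[0, s]] or [[0, s[] unless empty. On such sets the comparison of cdfs is a comparison
    of measures. *)
Let dF_upper (r : R) : 0 <= r -> (dF H (U r) <= dF G (U r) + a%:E)%E.
Proof.
move=> r0; pose D : set R := `[0, 1]%classic `\` U r.
have UE : U r = `[0, 1]%classic `\` D.
  rewrite /D setDDr setDv set0U setIidr// => x; rewrite /U /= in_itv/= andbT => rx.
  by apply: contraLR rx => /psi_out->; rewrite -leNgt.
have D01 : D `<=` `[0, 1]%classic by move=> x [].
have mD : measurable (D : set (measurableTypeR R)).
  by apply: measurableD => //; exact: measurable_itv.
have m01 : measurable (`[0, 1]%classic : set (measurableTypeR R)) by exact: measurable_itv.
have d01 F : dF F `[0, 1]%classic = 1%:E by rewrite dF_itv// cdf01_ge1.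
have dU F : dF F (U r) = (1 - dF F D)%E.
  have lt01 : (dF F `[0%R, 1%R]%classic < +oo)%E by rewrite d01 ltry.
  by rewrite UE (measureD m01 mD lt01) (setIidr D01) [X in (X - _)%E](d01 F).
have fin F : dF F D \is a fin_num by exact: fin_num_measure.
suff DGH : (dF G D <= dF H D + a%:E)%E.
  move: DGH; rewrite !dU -(fineK (fin G)) -(fineK (fin H)) -!EFinD -?EFinN -?EFinD !lee_fin; lra.
have Ddown x y : 0 <= y -> y <= x -> D x -> D y.
  move=> y0 yx [/=]; rewrite in_itv/= => /andP[x0 x1] nx; split=> /=.
    by rewrite in_itv/= y0 (le_trans yx).
  move=> ny; apply: nx; move: ny; rewrite /U /= !in_itv/= !andbT => /lt_le_trans; apply.
  exact: psi_homo.
have [D0|/set0P[d Dd]] := eqVneq D set0.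
  by rewrite D0 !measure0 add0e lee_fin.
have Dsup : has_sup D.
  by split; [exists d|exists 1 => x [/=]; rewrite in_itv/= => /andP[]].
have s0 : 0 <= sup D.
  by have := sup_upper_bound Dsup Dd; apply: le_trans; case: Dd => /=; rewrite in_itv/= => /andP[].
have [Ds|Ds] := pselect (D (sup D)).
  have -> : D = `[0, sup D]%classic.
    apply/seteqP; split => x /=; rewrite in_itv/=.
      move=> Dx; rewrite (sup_upper_bound Dsup Dx) andbT.
      by case: Dx => /=; rewrite in_itv/= => /andP[].
    by move=> /andP[x0 xs]; exact: Ddown Ds.
  by rewrite !dF_itv// -EFinD lee_fin.
have -> : D = `[0, sup D[%classic.
  apply/seteqP; split => x /=; rewrite in_itv/=.
    move=> Dx; rewrite lt_neqAle (sup_upper_bound Dsup Dx) andbT.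
    apply/andP; split; first by case: Dx => /=; rewrite in_itv/= => /andP[].
    by apply: contra_notN Ds => /eqP <-.
  move=> /andP[x0 xs]; have /sup_adherent/(_ Dsup)[y Dy xy] : 0 < sup D - x by rewrite subr_gt0.
  by apply: Ddown Dy => //; move: xy; lra.
exact: dF_itv_co.
Qed.

Let psi_mixin := isMeasurableFun.Build _ _ _ _ _ mpsi.
Let psi_pack : {mfun (measurableTypeR R) >-> R} := HB.pack psi psi_mixin.

(** Layer-cake formula: the integral of [psi] is the integral over [r >= 0] of the mass of
    [psi > r]. Each level loses at most [a], and levels [r >= M] are empty, which gives [a * M]. *)
Lemma Rintegral_dominance : \int[dF H]_x psi x <= \int[dF G]_x psi x + a * M.
Proof.
have psib x : `|psi x| <= M by have /andP[? ?] := psi0M x; rewrite ger0_norm.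
have M0 : 0 <= M := le_trans (normr_ge0 _) (psib 0).
have psi0 x : 0 <= psi x by case/andP: (psi0M x).
have EE F : (\int[dF F]_x psi x)%:E =
    (\int[lebesgue_measure]_(r in `[0%R, +oo[) dF F (U r))%E.
  rewrite (EFin_Rintegral (dF F) mpsi psib).
  have := @ge0_expectation_ccdf _ _ _ (dF F) psi_pack psi0.
  by rewrite expectation_def.
have mU F : measurable_fun (`[0%R, +oo[%classic : set R) (fun r => dF F (U r)).
  apply: measurable_funTS.
  exact: (@ccdf_measurable _ _ _ (dF F) psi_pack).
suff : ((\int[dF H]_x psi x)%:E <= (\int[dF G]_x psi x)%:E + (a * M)%:E)%E.
  by rewrite -EFinD lee_fin.
rewrite (EE H) (EE G).
have -> : (a * M)%:E = (\int[lebesgue_measure]_(r in `[0%R, +oo[) (a * \1_`[0%R, M[ r)%:E)%E.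
  under eq_integral do rewrite EFinM.
  rewrite ge0_integralZl_EFin//; last first.
    by apply/measurable_EFinP; exact: measurable_indic.
  rewrite integral_indic//= setIidl; last first.
    by move=> r; rewrite /= !in_itv/= andbT => /andP[].
  rewrite EFinM; congr (_ * _)%E; rewrite lebesgue_measure_itv/= lte_fin.
  by case: ltgtP M0 => // [_ _|<-//]; rewrite -EFinB subr0.
have mI : measurable_fun (`[0%R, +oo[%classic : set R) (fun r : R => (a * \1_`[0%R, M[ r)%:E).
  apply/measurable_EFinP; apply: measurable_funM; first exact: measurable_cst.
  exact: measurable_indic.
rewrite -ge0_integralD//=; [|exact: (mU G)|by move=> r _; rewrite lee_fin mulr_ge0].
apply: ge0_le_integral => //=.
- exact: (mU H).
- exact: emeasurable_funD (mU G) mI.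
move=> r; rewrite in_itv/= andbT => r0; rewrite indicE.
have [rM|rM] := ltP r M.
  by rewrite mem_set/= ?mulr1; [exact: dF_upper|rewrite in_itv/= r0].
rewrite (_ : U r = set0) ?measure0; first by rewrite adde_ge0// lee_fin mulr_ge0.
apply/seteqP; split => // x; rewrite /U /= in_itv/= andbT => rx.
by have /andP[_] := psi0M x; move: (le_lt_trans rM rx); rewrite ltNge => /negP.
Qed.

End dominance.

End dF_theory.

(** * Payoffs of a single deviator *)

Section deviation.
Variables (R : realType) (n : nat).
Implicit Types F H : cdf01 R.

Definition consrow (x : R) (y : 'rV[R]_n) : 'rV[R]_n.+1 :=
  \row_i oapp (fun j => y ord0 j) x (unlift ord0 i).

Lemma consrow0 x y : consrow x y ord0 ord0 = x.
Proof. by rewrite mxE unlift_none. Qed.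

Lemma consrow_lift x y j : consrow x y ord0 (lift ord0 j) = y ord0 j.
Proof. by rewrite mxE liftK. Qed.

Lemma cube_consrow x y :
  cube R n.+1 (consrow x y) <-> x \in `[0, 1]%R /\ cube R n y.
Proof.
split=> [xyc|[x01 yc] i].
  split; first by have := xyc ord0; rewrite consrow0.
  by move=> j; have := xyc (lift ord0 j); rewrite consrow_lift.
by have [j ->|->] := unliftP ord0 i; rewrite ?consrow_lift ?consrow0//; exact: yc.
Qed.

Lemma row_of_tuple_cons x (t : n.-tuple (measurableTypeR R)) :
  row_of_tuple (tuple_cons (x, t)) = consrow x (row_of_tuple t).
Proof.
apply/rowP => i; rewrite [LHS]mxE.
have [j ->|->] := unliftP ord0 i; rewrite ?consrow_lift ?consrow0 ?tnthS// mxE.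
by [].
Qed.

Variables (f : 'rV[R]_n.+1 -> R) (M : R).
Hypotheses (bf : borel_on_cube f)
  (f0M : forall x, cube R n.+1 x -> 0 <= f x <= M).

(** The deviator is player [ord0], facing [n] opponents. Integrating the opponents first
    ([payoff_at]) exhibits linearity in [H] and monotonicity in [x]; integrating the deviator first
    ([averaged_payoff]) prepares continuity in [F]. *)
Definition payoff_at F (x : R) : R := expected (f \o consrow x) (fun _ : 'I_n => F).

Definition averaged_payoff H (y : 'rV[R]_n) : R :=
  \int[dF H]_(x in `[0, 1]) f (consrow x y).

Lemma on_tuples_cons x (t : n.-tuple (measurableTypeR R)) :
  on_tuples f (tuple_cons (x, t)) =
  if x \in `[0, 1]%R then on_tuples (f \o consrow x) t else 0.
Proof.
rewrite /on_tuples !patchE /=.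
have -> : (tuple_cons (x, t) \in @unit_box R n.+1) =
    (x \in `[0, 1]%R) && (t \in @unit_box R n).
  apply/idP/andP => [|[x01]]; rewrite !inE => tb.
    split; first exact: (tb ord0).
    by move=> j; have := tb (lift ord0 j); rewrite tnthS.
  by move=> i; have [j ->|->//] := unliftP ord0 i; rewrite tnthS; exact: tb.
by case: (x \in _) => //=; rewrite row_of_tuple_cons.
Qed.

Let f0 z : cube R n.+1 z -> 0 <= f z. Proof. by move=> /f0M/andP[]. Qed.

Let M0 : 0 <= M.
Proof.
have /f0M/andP[h1 h2] : cube R n.+1 0.
  by move=> i; rewrite mxE in_itv/= lexx ler01.
exact: le_trans h2.
Qed.

Let g (z : measurableTypeR R * n.-tuple (measurableTypeR R)) := on_tuples f (tuple_cons z).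

Let mg : measurable_fun setT g.
Proof. by apply: measurableT_comp => //; exact: borel_on_tuples. Qed.

Let g0 z : 0 <= g z. Proof. exact: on_tuples_ge0. Qed.

Let gM z : g z <= M.
Proof. by apply: on_tuples_le => // y /f0M/andP[]. Qed.

Let gb z : `|g z| <= M. Proof. by rewrite ger0_norm. Qed.

Let law_rest H F : (fun i : 'I_n => dF (if lift ord0 i == ord0 then H else F)) = fun=> dF F.
Proof. by apply/funext => i. Qed.

Lemma payoff_atE F x : (payoff_at F \_ `[0, 1]) x =
  \int[product_law (fun _ : 'I_n => dF F)]_t g (x, t).
Proof.
rewrite patchE; case: ifPn => [|]; rewrite ?notin_setE ?inE => x01.
  rewrite /payoff_at expectedE; apply: eq_Rintegral => t _.
  by rewrite /g on_tuples_cons x01.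
rewrite -[LHS](Rintegral_prob_cst (product_law (fun _ : 'I_n => dF F))).
apply: eq_Rintegral => t _; rewrite /g on_tuples_cons.
by case: ifP x01.
Qed.

Lemma measurable_payoff_at F : measurable_fun setT (payoff_at F \_ `[0, 1]).
Proof.
have -> : payoff_at F \_ `[0, 1] =
    fun x => \int[product_law (fun _ : 'I_n => dF F)]_t g (x, t).
  by apply/funext => x; exact: payoff_atE.
exact: measurable_Rintegral2 gM.
Qed.

Lemma payoff_at_bounds F x : 0 <= (payoff_at F \_ `[0, 1]) x <= M.
Proof.
rewrite payoff_atE Rintegral_ge0//= (le_trans (ler_norm _))//.
apply: Rintegral_prob_norm_le => //.
exact: measurableT_comp mg _.
Qed.

Lemma payoff_at_homo F :
  (forall x x', cube R n.+1 x -> cube R n.+1 x' ->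
    (forall j, j != ord0 -> x' ord0 j = x ord0 j) ->
    x ord0 ord0 <= x' ord0 ord0 -> f x <= f x') ->
  forall x y, 0 <= x -> x <= y -> y <= 1 ->
  (payoff_at F \_ `[0, 1]) x <= (payoff_at F \_ `[0, 1]) y.
Proof.
move=> fhomo x y x0 xy y1; rewrite !payoff_atE.
apply: (@le_Rintegral_prob _ _ _ _ _ _ M M) => //.
- exact: measurableT_comp mg _.
- exact: measurableT_comp mg _.
move=> t; rewrite /g !on_tuples_cons !in_itv/= x0 y1 (le_trans xy y1) (le_trans x0 xy) /=.
rewrite /on_tuples !patchE; case: ifPn => //; rewrite inE => tb /=.
have tc : cube R n (row_of_tuple t).
  by move: tb; rewrite -row_of_tuple_cube.
apply: fhomo.
- by apply/cube_consrow; rewrite in_itv/= x0 (le_trans xy y1).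
- by apply/cube_consrow; rewrite in_itv/= y1 (le_trans x0 xy).
- by move=> j; have [k ->|->] := unliftP ord0 j; rewrite ?consrow_lift ?eqxx.
- by rewrite !consrow0.
Qed.

Lemma expected_payoff_at H F :
  expected f (fun j => if j == ord0 then H else F) =
  \int[dF H]_x (payoff_at F \_ `[0, 1]) x.
Proof.
rewrite expectedE (@product_lawS12 _ _ _ _ _ M)//; last 3 first.
- exact: borel_on_tuples.
- exact: on_tuples_ge0.
- by apply: on_tuples_le => // y /f0M/andP[].
rewrite (law_rest H F); apply: eq_Rintegral => x _; exact: esym (payoff_atE F x).
Qed.

Lemma on_tuples_averaged H t : on_tuples (averaged_payoff H) t = \int[dF H]_x g (x, t).
Proof.
rewrite /on_tuples patchE; case: ifPn => [|]; rewrite ?notin_setE ?inE => tb.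
  rewrite /= /averaged_payoff Rintegral_mkcond; apply: eq_Rintegral => x _.
  rewrite /g on_tuples_cons patchE mem_setE.
  by case: ifP => // _; rewrite /on_tuples patchE mem_set.
rewrite -[LHS](Rintegral_prob_cst (dF H)).
apply: eq_Rintegral => x _; rewrite /g on_tuples_cons; case: ifP => // _.
by rewrite /on_tuples patchE memNset.
Qed.

Lemma measurable_averaged H : measurable_fun setT (on_tuples (averaged_payoff H)).
Proof.
have -> : on_tuples (averaged_payoff H) = fun t => \int[dF H]_x g (x, t).
  by apply/funext => t; exact: on_tuples_averaged.
exact: measurable_Rintegral1 gM.
Qed.

Lemma averaged_bounds H y : cube R n y -> 0 <= averaged_payoff H y <= M.
Proof.
move=> yc; pose t : n.-tuple R := [tuple y ord0 i | i < n].
have yt : row_of_tuple t = y by apply/rowP => i; rewrite mxE tnth_mktuple.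
have tb : @unit_box R n t by move=> i; rewrite tnth_mktuple; exact: yc.
have := on_tuples_averaged H t; rewrite /on_tuples patchE mem_set//= yt => ->.
rewrite Rintegral_ge0//= (le_trans (ler_norm _))//.
apply: Rintegral_prob_norm_le => //.
exact: measurableT_comp mg _.
Qed.

Lemma expected_averaged H F :
  expected f (fun j => if j == ord0 then H else F) =
  expected (averaged_payoff H) (fun _ : 'I_n => F).
Proof.
rewrite !expectedE (@product_lawS21 _ _ _ _ _ M)//; last 3 first.
- exact: borel_on_tuples.
- exact: on_tuples_ge0.
- by apply: on_tuples_le => // y /f0M/andP[].
rewrite (law_rest H F); apply: eq_Rintegral => t _; exact: esym (on_tuples_averaged H t).
Qed.

Lemma ball_consrow x (y z : 'rV[R]_n) (e : R) : 0 < e ->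
  (forall j, `|y ord0 j - z ord0 j| < e) -> ball (consrow x y) e (consrow x z).
Proof.
move=> e0 yz; apply/ball_rowP => // i.
have [j ->|->] := unliftP ord0 i; first by rewrite !consrow_lift; exact: yz.
by rewrite !consrow0 subrr normr0.
Qed.

(* For fixed y the integrand is discontinuous only at the finitely many ties
   x = y_j, which an atomless H does not see. *)
Lemma averaged_continuous H : (forall x, dF H [set x] = 0%:E) ->
  (forall x, cube R n.+1 x -> (forall j, j != ord0 -> x ord0 ord0 != x ord0 j) ->
    f y @[y --> within (cube R n.+1) (nbhs x)] --> f x) ->
  {within cube R n, continuous (averaged_payoff H)}.
Proof.
move=> H0 fc; apply/subspace_continuousP => y yc.
apply/cvgrPdist_le => e e0; apply: contrapT => nnear.
(* Dominated convergence concerns sequences, so a failure of continuity is first turned into a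
   sequence [z N] tending to [y]. *)
have bad N : exists z, [/\ cube R n z, ball y N.+1%:R^-1 z &
    e < `|averaged_payoff H y - averaged_payoff H z|].
  apply: contrapT => /forallNP no; apply: nnear.
  apply/nbhs_ballP; exists N.+1%:R^-1; first by rewrite /= invr_gt0.
  move=> z yz zc /=; rewrite leNgt; apply/negP => ez.
  by apply: (no z).
have [z zP] := choice bad.
have integrandE w : cube R n w ->
    ((fun x => f (consrow x w)) \_ `[0, 1]) = fun x => g (x, [tuple w ord0 i | i < n]).
  move=> wc; apply/funext => x; rewrite /g on_tuples_cons patchE mem_setE.
  case: ifP => // _; rewrite /on_tuples patchE mem_set; last first.
    by move=> i; rewrite tnth_mktuple; exact: wc.
  by rewrite /=; congr (f (consrow _ _)); apply/rowP => i; rewrite mxE tnth_mktuple.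
have mw w : cube R n w -> measurable_fun (setT : set (measurableTypeR R))
    ((fun x => f (consrow x w)) \_ `[0, 1]).
  by move=> wc; rewrite integrandE//; exact: measurableT_comp mg _.
have wM w x : cube R n w -> `|((fun x => f (consrow x w)) \_ `[0, 1]) x| <= M.
  by move=> wc; rewrite integrandE//; exact: gb.
have avgE w : averaged_payoff H w = \int[dF H]_x ((fun x => f (consrow x w)) \_ `[0, 1]) x.
  by rewrite /averaged_payoff Rintegral_mkcond.
have near_z x (d : R) : 0 < d ->
    \forall N \near \oo, ball (consrow x y) d (consrow x (z N)).
  move=> d0; have := near_infty_natSinv_lt (PosNum d0); apply: filterS => N /= Nd.
  apply: ball_consrow => // j; apply: lt_trans Nd.
  have [_ zN _] := zP N; have N0 : 0 < N.+1%:R^-1 :> R by rewrite invr_gt0.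
  by move/(ball_rowP _ _ N0) : zN => /(_ j).
have cvg_f x : (forall j, x != y ord0 j) ->
    ((fun x => f (consrow x (z N))) \_ `[0, 1]) x @[N --> \oo] -->
    ((fun x => f (consrow x y)) \_ `[0, 1]) x.
  move=> xy; rewrite patchE; under eq_fun do rewrite patchE.
  rewrite mem_setE; have [x01|_] := boolP (x \in `[0, 1]%R); last exact: cvg_cst.
  move=> A /fc nA; have : nbhs (consrow x y) (fun w => cube R n.+1 w -> A (f w)).
    apply: nA; first exact/cube_consrow.
    by move=> j; have [k ->|->] := unliftP ord0 j; rewrite ?consrow_lift ?consrow0 ?eqxx.
  move=> /nbhs_ballP[d /= d0 dA]; have := near_z x _ d0.
  apply: filterS => N /dA; apply; apply/cube_consrow; split => //.
  by have [] := zP N.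
have : averaged_payoff H (z N) @[N --> \oo] --> averaged_payoff H y.
  rewrite avgE; under eq_fun do rewrite avgE.
  apply: fine_cvg; rewrite (EFin_Rintegral _ (mw _ yc) (fun x => wM _ x yc)).
  have [] := @dominated_convergence _ _ _ (dF H) setT measurableT
    (fun N x => (((fun x => f (consrow x (z N))) \_ `[0, 1]) x)%:E)
    (fun x => (((fun x => f (consrow x y)) \_ `[0, 1]) x)%:E) (fun=> M%:E) => //.
  - move=> N; apply/measurable_EFinP; apply: mw; by have [] := zP N.
  - by apply/measurable_EFinP; exact: mw.
  - have xy : \forall x \ae dF H, forall j, x != y ord0 j.
      apply: filter_forall => j; exists [set y ord0 j]; split => //.
      by move=> x /= /negP; rewrite negbK => /eqP.
    apply: (@filterS _ _ (ae_filter_ringOfSetsType (dF H)) _ _ _ xy) => x {}xy _.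
    apply/fine_cvgP; split; first exact: nearW.
    exact: cvg_f.
  - by apply: (@bounded_integrable _ _ _ (dF H) (fun=> M) M) => // x; rewrite ger0_norm.
  - apply: aeW => x N _; rewrite lee_fin; apply: wM; by have [] := zP N.
move=> /cvgrPdist_le/(_ _ e0)[N _ /(_ N (leqnn _))] /=.
by have [_ _] := zP N; rewrite ltNge => /negP.
Qed.

End deviation.

(** * Atomless approximations *)

Lemma lipschitz_right_continuous (R : realType) (f : R -> R) (L : R) : 0 <= L ->
  nondecreasing f -> (forall x y, x <= y -> f y - f x <= L * (y - x)) ->
  right_continuous f.
Proof.
move=> L0 fnd fL x; apply/cvgrPdist_le => e e0.
have L1 : 0 < L + 1 by rewrite ltr_wpDl.
have h0 : 0 < e / (L + 1) by rewrite divr_gt0.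
near=> z.
have xz : x < z by near: z; exact: nbhs_right_gt.
have zh : z < x + e / (L + 1) by near: z; apply: nbhs_right_lt; rewrite ltrDl.
rewrite distrC ger0_norm ?subr_ge0; last exact/fnd/ltW.
apply: le_trans (fL _ _ (ltW xz)) _.
apply: (@le_trans _ _ ((L + 1) * (e / (L + 1)))); last by rewrite mulrC divfK// gt_eqF.
by apply: ler_pM; rewrite ?subr_ge0 ?(ltW xz)// ?lerDl// lerBlDl ltW.
Unshelve. all: by end_near. Qed.

Section lipschitz_minorant.
Variables (R : realType) (H : cdf01 R) (N : nat).

Let L : R := N.+1%:R.

Let L0 : 0 < L. Proof. by rewrite ltr0n. Qed.

Let L0' : 0 <= L. Proof. exact: ltW. Qed.

Let penalty (x y : R) : R := H y + L * Num.max (x - y) 0.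

(* The largest L-Lipschitz minorant of H. *)
Definition envelope (x : R) : R := inf (range (penalty x)).

Let penalty_ge0 x y : 0 <= penalty x y.
Proof. by rewrite addr_ge0 ?cdf01_ge0// mulr_ge0// le_max lexx orbT. Qed.

Let has_inf_penalty x : has_inf (range (penalty x)).
Proof.
split; first by exists (penalty x x); exists x.
by exists 0 => _ [y _ <-].
Qed.

Let envelope_le x y : envelope x <= penalty x y.
Proof. by apply: ge_inf; [case: (has_inf_penalty x)|exists y]. Qed.

Lemma envelope_ge0 x : 0 <= envelope x.
Proof. by apply: lb_le_inf; [case: (has_inf_penalty x)|move=> _ [y _ <-]]. Qed.

Lemma envelope_le_cdf x : envelope x <= H x.
Proof.
by apply: le_trans (envelope_le x x) _; rewrite /penalty subrr maxxx mulr0 addr0.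
Qed.

Lemma envelope_homo : nondecreasing envelope.
Proof.
move=> x y xy; apply: lb_le_inf; first by case: (has_inf_penalty y).
move=> _ [z _ <-]; apply: le_trans (envelope_le x z) _.
by rewrite lerD2l ler_pM2l// ge_max !le_max lexx orbT andbT lerD2r xy.
Qed.

Lemma envelope_lipschitz x y : x <= y -> envelope y - envelope x <= L * (y - x).
Proof.
move=> xy; rewrite lerBlDr -lerBlDl; apply: lb_le_inf; first by case: (has_inf_penalty x).
move=> _ [z _ <-]; rewrite lerBlDl; apply: le_trans (envelope_le y z) _.
rewrite /penalty addrCA lerD2l -mulrDr ler_pM2l//.
rewrite ge_max; apply/andP; split.
  by rewrite -[y - z](subrKA x) lerD2l le_max lexx.
by rewrite addr_ge0 ?subr_ge0// le_max lexx orbT.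
Qed.

(** Going down by more than [1/L] costs more than 1, the largest value of a cdf. *)
Lemma cdf_le_envelope x : H (x - L^-1) <= envelope x.
Proof.
apply: lb_le_inf; first by case: (has_inf_penalty x).
move=> _ [y _ <-]; have [yx|xy] := leP (x - L^-1) y.
  rewrite -[leLHS]addr0; apply: lerD; first exact: cdf01_homo.
  by rewrite mulr_ge0// le_max lexx orbT.
rewrite (le_trans (cdf01_le1 _ _))// -[leLHS]add0r; apply: lerD; first exact: cdf01_ge0.
rewrite -[leLHS](@mulfV _ L) ?gt_eqF// ler_pM2l// le_max.
by apply/orP; left; rewrite lerBrDl -lerBrDr ltW.
Qed.

Lemma envelope_le0 x : x <= 0 -> envelope x = 0.
Proof.
move=> x0; apply/eqP; rewrite eq_le envelope_ge0 andbT.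
apply/ler_addgt0Pr => e e0; rewrite add0r.
have d0 : 0 < e / L by rewrite divr_gt0.
apply: le_trans (envelope_le x (x - e / L)) _.
rewrite /penalty cdf01_lt0; last by rewrite ltrBlDr (le_lt_trans x0)// add0r.
by rewrite add0r opprB addrC subrK (max_idPl (ltW d0)) mulrC divfK// gt_eqF.
Qed.

(** The envelope is frozen at 1, where it may be smaller than 1. The missing mass is spread
    uniformly over [[0, 1]], which keeps the function Lipschitz. *)
Definition smoothing (x : R) : R :=
  envelope (Num.min x 1) + (1 - envelope 1) * clip x.

Let defect0 : 0 <= 1 - envelope 1.
Proof. by rewrite subr_ge0 (le_trans (envelope_le_cdf 1))// cdf01_le1. Qed.

Let defect1 : 1 - envelope 1 <= 1.
Proof. by rewrite gerBl envelope_ge0. Qed.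

Let smoothing_homo : nondecreasing smoothing.
Proof.
move=> x y xy; apply: lerD.
  by apply: envelope_homo; rewrite le_min !ge_min xy lexx orbT.
by apply: ler_wpM2l => //; exact: clip_homo.
Qed.

Let min_lip (x y : R) : x <= y -> Num.min y 1 - Num.min x 1 <= y - x.
Proof. by move=> xy; case: (leP x 1) => x1; case: (leP y 1) => y1; lra. Qed.

Let smoothing_lipschitz x y : x <= y -> smoothing y - smoothing x <= (L + 1) * (y - x).
Proof.
move=> xy; rewrite /smoothing opprD addrACA -mulrBr [leRHS]mulrDl mul1r; apply: lerD.
  apply: le_trans (envelope_lipschitz _) _.
    by rewrite le_min !ge_min xy lexx orbT.
  by rewrite ler_pM2l// min_lip.
apply: (@le_trans _ _ (1 * (clip y - clip x))).
  by rewrite ler_wpM2r// subr_ge0 clip_homo.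
by rewrite mul1r; exact: clip_lip.
Qed.

Let smoothing_rc : right_continuous smoothing.
Proof.
apply: (lipschitz_right_continuous _ smoothing_homo smoothing_lipschitz).
by rewrite addr_ge0// ltW.
Qed.

Let smoothing_lt0 x : x < 0 -> smoothing x = 0.
Proof.
move=> x0; rewrite /smoothing clip_le0 ?ltW// mulr0 addr0 envelope_le0//.
by rewrite ge_min ltW.
Qed.

Let smoothing_ge1 x : 1 <= x -> smoothing x = 1.
Proof.
by move=> x1; rewrite /smoothing clip_ge1// mulr1 (min_idPr x1) addrC subrK.
Qed.

Definition smoothed : cdf01 R :=
  cdf01_of_function smoothing_homo smoothing_rc smoothing_lt0 smoothing_ge1.

Lemma smoothed_atomless x : dF smoothed [set x] = 0%:E.
Proof.
apply: (@dF_lipschitz _ _ (L + 1)); last exact: smoothing_lipschitz.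
by rewrite addr_ge0// ltW.
Qed.

(** First-order dominance of the smoothed law over [H] up to the respread mass. This error vanishes
    as [N] grows only if [H] has no atom at 1. *)
Lemma smoothed_le x : smoothed x <= H x + (1 - H (1 - L^-1)).
Proof.
rewrite /= /smoothing; apply: lerD.
  apply: le_trans (envelope_homo _) (envelope_le_cdf x).
  by rewrite ge_min lexx.
apply: (@le_trans _ _ (1 - envelope 1)); last by rewrite lerD2l lerN2 cdf_le_envelope.
by rewrite ler_piMr// clip_le1.
Qed.

Lemma le_smoothed x : H (x - L^-1) <= smoothed x.
Proof.
have [x1|x1] := leP x 1; last by rewrite (@cdf01_ge1 _ smoothed _ (ltW x1)) cdf01_le1.
rewrite /= /smoothing (min_idPl x1) -[leLHS]addr0; apply: lerD.
  exact: cdf_le_envelope.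
by rewrite mulr_ge0// clip_ge0.
Qed.

End lipschitz_minorant.

Section smoothing_limit.
Variables (R : realType) (H : cdf01 R).
Hypothesis H1 : forall e : R, 0 < e -> exists2 x, x < 1 & 1 - e < H x.

Lemma defect_cvg0 : 1 - H (1 - N.+1%:R^-1) @[N --> \oo] --> (0 : R).
Proof.
apply/cvgrPdist_le => e e0; have [x x1 xe] := H1 e0.
have x10 : 0 < 1 - x by rewrite subr_gt0.
have := near_infty_natSinv_lt (PosNum x10); apply: filterS => N /= Nx.
rewrite sub0r normrN ger0_norm ?subr_ge0 ?cdf01_le1//.
rewrite lerBlDr -lerBlDl; apply: le_trans (ltW xe) _; apply: cdf01_homo.
by rewrite lerBrDl -lerBrDr ltW.
Qed.

Lemma smoothed_cvg : smoothed H N @[N --> \oo] --> H.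
Proof.
apply: weak_cvg_levy => x y e xy e0.
have yx0 : 0 < y - x by rewrite subr_gt0.
have h1 := near_infty_natSinv_lt (PosNum yx0).
have /cvgrPdist_le/(_ _ e0) h2 := defect_cvg0.
apply: filterS2 h1 h2 => N /= Nyx.
rewrite sub0r normrN ger0_norm ?subr_ge0 ?cdf01_le1// => dN; split.
  rewrite lerBlDr; apply: (@le_trans _ _ (smoothed H N y)); last by rewrite lerDl ltW.
  apply: le_trans (le_smoothed H N y); apply: cdf01_homo.
  by rewrite lerBrDl -lerBrDr ltW.
apply: le_trans (smoothed_le H N x) _; apply: lerD => //.
by apply: cdf01_homo; exact: ltW.
Qed.

End smoothing_limit.

Lemma continuous_unit_patch (R : realType) (f : R -> R) :
  {within `[0, 1], continuous f} ->
  measurable_fun (setT : set (measurableTypeR R)) (f \_ `[0, 1]) /\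
  exists M, forall x, `|(f \_ `[0, 1]) x| <= M.
Proof.
move=> cf; split.
  apply/(measurable_restrictT _ (@measurable_itv R `[0, 1]%R)).
  by apply: subspace_continuous_measurable_fun => //; exact: measurable_itv.
have [c _ cP] := EVT_max ler01 cf; have [d _ dP] := EVT_min ler01 cf.
exists (`|f c| + `|f d|) => x; rewrite patchE; case: ifPn => [|]; last first.
  by rewrite normr0 addr_ge0.
rewrite inE => x01; have := cP x x01; have := dP x x01.
have := ler_norm (f c); have := ler_norm (- f d); rewrite normrN.
have := normr_ge0 (f c); have := normr_ge0 (f d).
by rewrite ler_norml; lra.
Qed.

(** * Point masses and removal of the atom at 1 *)

Section point_mass.
Variables (R : realType) (b : R).
Hypothesis b01 : 0 <= b <= 1.

Let f (x : R) : R := (b <= x)%R%:R.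

Let f_nd : nondecreasing f.
Proof.
move=> x y xy; rewrite /f; case: (leP b x) => [bx|_]; last exact: ler0n.
by rewrite (le_trans bx xy).
Qed.

Let f_rc : right_continuous f.
Proof.
move=> x; apply: cvg_near_cst; rewrite /f.
have [bx|xb] := leP b x; near=> y.
  have xy : x <= y by near: y; exact: nbhs_right_ge.
  by rewrite (le_trans bx xy).
have yb : y < b by near: y; exact: nbhs_right_lt.
by rewrite leNgt yb.
Unshelve. all: by end_near. Qed.

Let f_lt0 x : x < 0 -> f x = 0.
Proof. by move=> x0; rewrite /f leNgt (lt_le_trans x0)//; case/andP: b01. Qed.

Let f_ge1 x : 1 <= x -> f x = 1.
Proof. by move=> x1; rewrite /f (le_trans _ x1)//; case/andP: b01. Qed.

Definition point_mass : cdf01 R := cdf01_of_function f_nd f_rc f_lt0 f_ge1.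

Lemma point_massE x : point_mass x = (b <= x)%R%:R.
Proof. by []. Qed.

Lemma Rintegral_point_mass (g : R -> R) :
  measurable_fun (setT : set (measurableTypeR R)) g ->
  \int[dF point_mass]_x g x = g b.
Proof.
move=> mg; rewrite /Rintegral.
rewrite (eq_measure_integral [the {measure set (measurableTypeR R) -> \bar R} of @dirac _ (measurableTypeR R) b R]).
  rewrite integral_dirac//; first by rewrite diracT mul1e.
  exact/measurable_EFinP.
move=> A mA _; apply: lebesgue_stieltjes_measure_unique => // I [[u v]] /= _ <-.
have [uv|vu] := leP u v; last first.
  by rewrite set_itv_ge ?measure0// bnd_simp -leNgt ltW.
rewrite [LHS](dF_itv_oc point_mass uv) /= diracE mem_setE in_itv/= /f.
rewrite ltNge andbC; have [bu|ub] := leP b u; last by rewrite subr0 andbT.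
by rewrite (le_trans bu uv) subrr.
Qed.

End point_mass.

Section top_atom.
Variables (R : realType) (H : cdf01 R).

Let e0 : 0 <= (0 : R) <= 1. Proof. by rewrite lexx ler01. Qed.
Let e1 : 0 <= (1 : R) <= 1. Proof. by rewrite lexx ler01. Qed.
Let bottom := point_mass e0.
Let top := point_mass e1.

Let h := sup (H @` [set x | x < 1]).

Let h_sup : has_sup (H @` [set x | x < 1]).
Proof.
split; first by exists (H 0); exists 0 => //=; exact: ltr01.
by exists 1 => _ [x _ <-]; exact: cdf01_le1.
Qed.

Let le_h x : x < 1 -> H x <= h.
Proof. by move=> x1; apply: sup_upper_bound => //; exists x. Qed.

(** The atom of [H] at 1, since [h] is the left limit of [H] there. *)
Definition top_mass : R := 1 - h.

Lemma top_mass_ge0 : 0 <= top_mass.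
Proof.
by rewrite subr_ge0; apply: ge_sup; [case: h_sup|move=> _ [x _ <-]; exact: cdf01_le1].
Qed.

Let m (x : R) : R := H x + top_mass * bottom x - top_mass * top x.

Let m_nd : nondecreasing m.
Proof.
move=> x y xy; rewrite /m /bottom /top !point_massE.
have tm := top_mass_ge0.
have [x1|x1] := leP 1 x.
  by rewrite !cdf01_ge1 ?(le_trans x1)// !(le_trans ler01)// ?(le_trans x1).
have [y1|y1] := leP 1 y; last first.
  apply: lerB => //; apply: lerD; first exact: cdf01_homo.
  by apply: ler_wpM2l => //; rewrite ler_nat; case: (leP 0 x) => // x0; rewrite (le_trans x0 xy).
rewrite (cdf01_ge1 H y1) (le_trans ler01 y1).
have hx := le_h x1; have : top_mass = 1 - h by [].
by case: (leP 0 x) => _ /=; lra.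
Qed.

Let m_rc : right_continuous m.
Proof.
have rc (F : cdf01 R) : right_continuous F.
  by move=> x; exact: cumulative_is_right_continuous.
move=> x; apply: cvgB; last by apply: cvgMl_tmp; exact: (rc top).
by apply: cvgD; [exact: rc|apply: cvgMl_tmp; exact: (rc bottom)].
Qed.

Let m_lt0 x : x < 0 -> m x = 0.
Proof.
by move=> x0; rewrite /m !cdf01_lt0// !mulr0 subr0 addr0.
Qed.

Let m_ge1 x : 1 <= x -> m x = 1.
Proof. by move=> x1; rewrite /m !cdf01_ge1// addrK. Qed.

Definition lowered : cdf01 R := cdf01_of_function m_nd m_rc m_lt0 m_ge1.

Lemma lowered_no_top (e : R) : 0 < e -> exists2 x, x < 1 & 1 - e < lowered x.
Proof.
move=> e0'; have [_ [x /= x1 <-] hx] := sup_adherent e0' h_sup.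
exists (Num.max x 0); first by rewrite gt_max x1 ltr01.
rewrite /= /m /bottom /top !point_massE.
have -> : (0 <= Num.max x 0) = true by rewrite le_max lexx orbT.
have -> : (1 <= Num.max x 0) = false by apply/negbTE; rewrite -ltNge gt_max x1 ltr01.
have : H x <= H (Num.max x 0) by apply: cdf01_homo; rewrite le_max lexx.
by rewrite /top_mass; move: hx; rewrite -/h /=; lra.
Qed.

Lemma Rintegral_lowered (g : R -> R) (M : R) :
  measurable_fun setT g -> (forall x, `|g x| <= M) ->
  \int[dF H]_x g x = \int[dF lowered]_x g x + top_mass * (g 1 - g 0).
Proof.
move=> mg gM; have tm := top_mass_ge0.
have tm1 : 0 < 1 + top_mass by rewrite ltr_pwDl.
(* [lowered] is a signed combination, not a mixture. Moving the negative term across and normalizing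
   by [1 + top_mass], the same cdf is a mixture of [H] and [bottom] and also one of [lowered] and
   [top], with equal weights. *)
pose t := top_mass / (1 + top_mass).
have t01 : 0 <= t <= 1.
  by rewrite /t divr_ge0 ?(ltW tm1)//= ler_pdivrMr// mul1r lerDr.
have tE : 1 - t = (1 + top_mass)^-1.
  by rewrite /t -[X in X - _](@divff _ (1 + top_mass)) ?gt_eqF// -mulrBl addrK mul1r.
have t1 : 1 - t != 0 by rewrite tE invr_neq0// gt_eqF.
have key : (1 - t) * top_mass = t by rewrite tE mulrC.
pose w (j : 'I_2) := if j == ord0 then 1 - t else t.
have w0 j : 0 <= w j by rewrite /w; case: ifP => _; move: t01; lra.
have mixw (A B : cdf01 R) : (forall x, mix t H bottom x = (1 - t) * A x + t * B x) ->
    \int[dF (mix t H bottom)]_x g x = (1 - t) * \int[dF A]_x g x + t * \int[dF B]_x g x.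
  move=> AB; rewrite (@Rintegral_mixture _ 1 w (fun j => if j == ord0 then A else B) _ w0 _ _ M)//.
    by rewrite big_ord_recl big_ord1.
  by move=> x; rewrite AB big_ord_recl big_ord1.
have E1 := mixw H bottom (fun x => mixE _ _ _ t01).
have E2 : \int[dF (mix t H bottom)]_x g x =
    (1 - t) * \int[dF lowered]_x g x + t * \int[dF top]_x g x.
  apply: mixw => x; rewrite mixE//= /m.
  by rewrite mulrBr mulrDr !mulrA key subrK.
have := etrans (esym E1) E2.
rewrite (Rintegral_point_mass e0 mg) (Rintegral_point_mass e1 mg) => {}E2; apply: (mulfI t1).
by rewrite mulrDr mulrA key mulrBr addrA -E2 addrK.
Qed.

End top_atom.

(** * First-order bounds on the cost and profitable removal of atoms *)

Section cost.
Variables (R : realType) (C : cdf01 R -> R) (c : cdf01 R -> R -> R).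
Hypotheses (C_convex : forall (t : R) (F G : cdf01 R), 0 <= t <= 1 ->
    C (mix t F G) <= (1 - t) * C F + t * C G)
  (C_continuous : continuous C)
  (c_continuous : forall F, {within `[0, 1], continuous (c F)})
  (C_derivative : forall F G : cdf01 R,
    e^-1 * (C (mix e F G) - C F) @[e --> 0^'+] -->
      \int[dF G]_(x in `[0, 1]) c F x - \int[dF F]_(x in `[0, 1]) c F x).

(** By convexity every difference quotient with [0 < e <= 1] is at most [C G - C F], and so is the
    limit. *)
Lemma subgradient (F G : cdf01 R) :
  \int[dF G]_(x in `[0, 1]) c F x - \int[dF F]_(x in `[0, 1]) c F x <= C G - C F.
Proof.
have cst : (fun=> C G - C F) e @[e --> (0 : R)^'+] --> C G - C F by exact: cvg_cst.
apply: (ler_cvg_to (@C_derivative F G) cst).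
near=> e.
have e0 : 0 < e by near: e; exact: nbhs_right_gt.
have e1 : e <= 1 by near: e; exact: nbhs_right_le.
have e01 : 0 <= e <= 1 by rewrite (ltW e0).
rewrite mulrC ler_pdivrMr//; have := C_convex F G e01; lra.
Unshelve. all: by end_near. Qed.

Variables (pibar eta1 : R).
Hypotheses (eta1_gt0 : 0 < eta1)
  (c_gap : forall F, c F 0 + pibar + eta1 <= c F 1).

(** The subgradient inequality at [lowered H] in the direction of [H] only sees the mass moved
    between 0 and 1: it yields the atom times [c 1 - c 0], which exceeds [pibar]. *)
Lemma cost_lowered (H : cdf01 R) :
  C (lowered H) + top_mass H * pibar <= C H.
Proof.
have := subgradient (lowered H) H.
rewrite [X in X - _]Rintegral_mkcond [X in _ - X]Rintegral_mkcond.
have [mc [M cM]] := continuous_unit_patch (@c_continuous (lowered H)).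
rewrite (Rintegral_lowered H mc cM) !patchE !mem_setE !in_itv/= !lexx ler01/=.
rewrite addrAC subrr add0r => sub.
have : top_mass H * pibar <= top_mass H * (c (lowered H) 1 - c (lowered H) 0).
  apply: ler_wpM2l; first exact: top_mass_ge0.
  by rewrite lerBrDl; apply: le_trans (c_gap _); rewrite lerDl ltW.
lra.
Qed.

Variable psi : R -> R.
Hypotheses (mpsi : measurable_fun (setT : set (measurableTypeR R)) psi)
  (psi0M : forall x, 0 <= psi x <= pibar)
  (psi_homo : forall x y, 0 <= x -> x <= y -> y <= 1 -> psi x <= psi y)
  (psi_out : forall x, x \notin `[0, 1]%R -> psi x = 0).

Let psib x : `|psi x| <= pibar.
Proof. by have /andP[? ?] := psi0M x; rewrite ger0_norm. Qed.

(** The gross loss is at most the moved mass times [pibar], which the saving in cost covers. *)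
Let lowered_better (H : cdf01 R) :
  \int[dF H]_x psi x - C H <= \int[dF (lowered H)]_x psi x - C (lowered H).
Proof.
rewrite (Rintegral_lowered H mpsi psib).
have : top_mass H * (psi 1 - psi 0) <= top_mass H * pibar.
  apply: ler_wpM2l; first exact: top_mass_ge0.
  by have := psi0M 1; have := psi0M 0; lra.
by have := cost_lowered H; lra.
Qed.

Let combine (i0 i1 i2 c0 c1 c2 q x : R) : i0 - c0 <= i1 - c1 -> i1 <= i2 + q ->
  `|c1 - c2| <= x / 2 -> `|0 - q| <= x / 2 -> i0 - c0 <= i2 - c2 + x.
Proof. by rewrite !ler_norml => ? ? /andP[? ?] /andP[? ?]; lra. Qed.

(* Mass at 1 cannot be pushed up to smooth it out; by the gap between the
   marginal costs at 1 and at 0 it is better moved to 0 first. *)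
Lemma atomless_deviation (H : cdf01 R) (e : R) : 0 < e ->
  exists2 G : cdf01 R, (forall x, dF G [set x] = 0%:E) &
    \int[dF H]_x psi x - C H <= \int[dF G]_x psi x - C G + e.
Proof.
move=> e0; have e2 : 0 < e / 2 by rewrite divr_gt0.
pose d N : R := 1 - lowered H (1 - N.+1%:R^-1).
have no_top := @lowered_no_top R H.
have cC : C (smoothed (lowered H) N) @[N --> \oo] --> C (lowered H).
  by apply: (cvg_comp _ _ (smoothed_cvg no_top)); exact: C_continuous.
have dM : d N * pibar @[N --> \oo] --> (0 : R).
  by rewrite -(mul0r pibar); apply: cvgMr_tmp; exact: defect_cvg0.
have [N [hC hd]] : exists N, `|C (lowered H) - C (smoothed (lowered H) N)| <= e / 2 /\
    `|0 - d N * pibar| <= e / 2.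
  move/cvgrPdist_le : cC => /(_ _ e2) cC; move/cvgrPdist_le : dM => /(_ _ e2) dM.
  have [N _ NP] := filterI cC dM.
  by exists N; exact: NP (leqnn N).
exists (smoothed (lowered H) N); first exact: smoothed_atomless.
have d0 : 0 <= d N by rewrite subr_ge0 cdf01_le1.
have := Rintegral_dominance d0 (smoothed_le (lowered H) N) mpsi psi0M psi_homo psi_out.
by move=> dom; exact: combine (lowered_better H) dom hC hd.
Qed.

End cost.

(** * Equilibria in finite families of deviations *)

Lemma cvg_coord_within (R : realType) k (A : set 'rV[R]_k) (a : 'rV[R]_k) j :
  (fun b : 'rV[R]_k => b ord0 j) @ within A (nbhs a) --> a ord0 j.
Proof.
move=> B /(@coord_continuous R 1 k ord0 j a) nB.
by apply: (@filterS _ _ (nbhs_filter a) _ _ _ nB) => b bB _; exact: bB.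
Qed.

Section convex_combination.
Variables (R : realType) (k : nat) (H : 'I_k.+1 -> cdf01 R).

(** The guard [simplex a] in the conclusion allows a choice function on all row vectors; off the
    simplex its value is arbitrary. *)
Lemma convex_combination_exists (a : 'rV[R]_k.+1) : exists F : cdf01 R,
  simplex a -> forall x, F x = \sum_j a ord0 j * H j x.
Proof.
have [[a0 a1]|na] := pselect (simplex a); last by exists (H ord0).
pose f (x : R) : R := \sum_j a ord0 j * H j x.
have f_nd : nondecreasing f.
  by move=> x y xy; apply: ler_sum => j _; apply: ler_wpM2l => //; exact: cdf01_homo.
have f_rc : right_continuous f.
  move=> x; apply: cvg_sumr => j _; apply: cvgMl_tmp.
  exact: cumulative_is_right_continuous.
have f_lt0 x : x < 0 -> f x = 0.
  by move=> x0; rewrite /f big1// => j _; rewrite cdf01_lt0// mulr0.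
have f_ge1 x : 1 <= x -> f x = 1.
  by move=> x1; rewrite -[RHS]a1; apply: eq_bigr => j _; rewrite cdf01_ge1// mulr1.
by exists (cdf01_of_function f_nd f_rc f_lt0 f_ge1).
Qed.

Definition convex_combination (a : 'rV[R]_k.+1) : cdf01 R :=
  sval (cid (convex_combination_exists a)).

Lemma convex_combinationE a x : simplex a ->
  convex_combination a x = \sum_j a ord0 j * H j x.
Proof. by move=> sa; rewrite /convex_combination; case: cid => F /= ->. Qed.

Lemma Rintegral_convex_combination a (g : R -> R) (M : R) : simplex a ->
  measurable_fun setT g -> (forall x, `|g x| <= M) ->
  \int[dF (convex_combination a)]_x g x = \sum_j a ord0 j * \int[dF (H j)]_x g x.
Proof.
move=> sa mg gM; apply: (Rintegral_mixture _ _ mg gM); first by case: sa.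
by move=> x; exact: convex_combinationE.
Qed.

(** The integral of a fixed test function is linear in the weights, so the combination depends
    weakly continuously on them. *)
Lemma continuous_convex_combination (phi : cdf01 R -> R) : continuous phi ->
  {within @simplex R k.+1, continuous (phi \o convex_combination)}.
Proof.
move=> cphi; apply/subspace_continuousP => a sa.
have FF : Filter (within (@simplex R k.+1) (nbhs a)).
  by apply: within_filter; exact: nbhs_filter.
have cF : convex_combination b @[b --> within (@simplex R k.+1) (nbhs a)] -->
    convex_combination a.
  apply/weak_cvgP => f cf; have [mf [M fM]] := continuous_unit_patch cf.
  have intE b : simplex b -> \int[dF (convex_combination b)]_(x in `[0, 1]) f x =
      \sum_j b ord0 j * \int[dF (H j)]_x (f \_ `[0, 1]) x.
    by move=> sb; rewrite Rintegral_mkcond (Rintegral_convex_combination sb mf fM).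
  rewrite (intE _ sa).
  have : (fun b : 'rV[R]_k.+1 => \sum_j b ord0 j * \int[dF (H j)]_x (f \_ `[0, 1]) x)
      @ within (@simplex R k.+1) (nbhs a) -->
      \sum_j a ord0 j * \int[dF (H j)]_x (f \_ `[0, 1]) x.
    apply: cvg_sumr => j _; apply: cvgMr_tmp.
    exact: cvg_coord_within.
  have wT : within (@simplex R k.+1) (nbhs a) (@simplex R k.+1).
    exact: (@filterE _ _ (nbhs_filter a)).
  move=> cvgS A /cvgS; apply: filterS2 wT => b sb Ab.
  by rewrite /= intE.
exact: (cvg_comp _ _ cF (cphi _)).
Qed.

End convex_combination.

(** * A variational inequality on the simplex *)

Section variational.
Variable R : realType.

Definition pos (x : R) : R := (x + `|x|) / 2.

Lemma pos_ge0 x : 0 <= pos x.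
Proof. by rewrite /pos; case: (leP 0 x) => x0; [rewrite ger0_norm|rewrite ltr0_norm]; lra. Qed.

Lemma pos_le0 x : x <= 0 -> pos x = 0.
Proof. by move=> x0; rewrite /pos ler0_norm// subrr mul0r. Qed.

Lemma pos_gt0 x : 0 < pos x -> 0 < x.
Proof. by rewrite !ltNge; apply: contra => /pos_le0->. Qed.

Lemma le_pos x : x <= pos x.
Proof. by rewrite /pos; case: (leP 0 x) => x0; [rewrite ger0_norm|rewrite ltr0_norm]; lra. Qed.

(* The Brouwer-Nash map x_i + g_i^+ / (1 + sum_j g_j^+) in the form of the
   covering lemma for the simplex. *)
Lemma simplex_variational k (g : 'I_k.+1 -> 'rV[R]_k.+1 -> R) :
  (forall i, {within @simplex R k.+1, continuous (g i)}) ->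
  (forall x, simplex x -> \sum_i x ord0 i * g i x <= 0) ->
  exists2 x, simplex x & forall i, g i x <= 0.
Proof.
move=> gc gx; pose S x := \sum_i pos (g i x).
pose q i (x : 'rV[R]_k.+1) := x ord0 i * S x - pos (g i x).
have posc i : {within @simplex R k.+1, continuous (pos \o g i)}.
  apply/subspace_continuousP => x sx; have /subspace_continuousP/(_ x sx) c := gc i.
  apply: cvgMr_tmp; apply: cvgD => //.
  exact: (@cvg_norm R R^o).
have qc i : {within @simplex R k.+1, continuous (q i)}.
  apply/subspace_continuousP => x sx.
  have FF : Filter (within (@simplex R k.+1) (nbhs x)).
    by apply: within_filter; exact: nbhs_filter.
  have pc j : pos (g j y) @[y --> within (@simplex R k.+1) (nbhs x)] --> pos (g j x).
    by have /subspace_continuousP/(_ x sx) := posc j.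
  apply: cvgB => //; apply: cvgM; last by apply: cvg_sumr.
  exact: cvg_coord_within.
(* The [q i] sum to zero, so they cannot all be positive: this is the covering hypothesis. *)
have sumq x : simplex x -> \sum_i q i x = 0.
  by move=> [_ x1]; rewrite sumrB -mulr_suml x1 mul1r subrr.
have [x sx|x i [x0 _] xi|x sx qx] := simplex_covering ord0 qc.
- apply: contrapT => /forallNP no; have /eqP := sumq x sx.
  rewrite gt_eqF// (bigD1 ord0)//= ltr_pwDl//.
    by rewrite ltNge; apply/negP; exact: no.
  by apply: sumr_ge0 => i _; rewrite leNgt; apply/negP => /ltW; exact: no.
- by rewrite /q xi mul0r sub0r oppr_le0 pos_ge0.
exists x => // i; rewrite leNgt; apply/negP => gi.
have S0 : 0 < S x.
  rewrite /S (bigD1 i)//= ltr_pwDl//; first exact: lt_le_trans gi (le_pos _).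
  by apply: sumr_ge0 => j _; exact: pos_ge0.
have [x0 x1] := sx.
(* If some gain is positive, then [S x > 0], and [q j x <= 0] makes the gain positive at every [j]
   of positive weight. The weighted sum of gains would then be positive. *)
have gx0 j : 0 < x ord0 j -> 0 < g j x.
  move=> xj; apply: pos_gt0; apply: (@lt_le_trans _ _ (x ord0 j * S x)).
    exact: mulr_gt0.
  by have := qx j; rewrite /q subr_le0.
have [j xj] : exists j, 0 < x ord0 j.
  apply: contrapT => /forallNP no; have : \sum_i x ord0 i <= 0.
    by apply: sumr_le0 => j _; rewrite leNgt; apply/negP; exact: no.
  by rewrite x1 ler10.
have := gx x sx; rewrite leNgt => /negP; apply.
rewrite (bigD1 j)//= ltr_pwDl//; first by rewrite mulr_gt0// gx0.
apply: sumr_ge0 => l _; have := x0 l; rewrite le_eqVlt => /predU1P[<-|xl].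
  by rewrite mul0r.
by rewrite mulr_ge0// ltW// gx0.
Qed.

End variational.

(** * Gains from deviation and existence of the equilibrium *)

Section equilibrium.
Variables (R : realType) (n : nat) (pi : 'I_n.+1 -> 'rV[R]_n.+1 -> R) (pibar : R)
  (C : cdf01 R -> R) (c : cdf01 R -> R -> R) (eta1 : R).
Hypotheses (pi_borel : forall i, borel_on_cube (pi i))
  (P1 : forall i x, cube R n.+1 x -> 0 <= pi i x <= pibar)
  (P2 : forall (s : 'S_n.+1) i x, cube R n.+1 x -> pi i (col_perm s x) = pi (s i) x)
  (P3 : forall i x, cube R n.+1 x -> (forall j, j != i -> x ord0 i != x ord0 j) ->
    pi i y @[y --> within (cube R n.+1) (nbhs x)] --> pi i x)
  (P4 : forall i x x', cube R n.+1 x -> cube R n.+1 x' ->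
    (forall j, j != i -> x' ord0 j = x ord0 j) -> x ord0 i <= x' ord0 i ->
    pi i x <= pi i x')
  (P5 : exists Pi : 'rV[R]_n.+1 -> R,
    [/\ exists M, forall x, cube R n.+1 x -> `|Pi x| <= M,
        {within cube R n.+1, continuous Pi},
        forall (s : 'S_n.+1) x, cube R n.+1 x -> Pi (col_perm s x) = Pi x &
        forall x, cube R n.+1 x -> \sum_(i < n.+1) pi i x = Pi x])
  (C1_convex : forall (t : R) (F G : cdf01 R), 0 <= t <= 1 ->
    C (mix t F G) <= (1 - t) * C F + t * C G)
  (C1_continuous : continuous C)
  (C2_continuous : forall F, {within `[0, 1], continuous (c F)})
  (C2_derivative : forall F G : cdf01 R,
    e^-1 * (C (mix e F G) - C F) @[e --> 0^'+] -->
      \int[dF G]_(x in `[0, 1]) c F x - \int[dF F]_(x in `[0, 1]) c F x)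
  (eta1_gt0 : 0 < eta1)
  (C3 : forall F, c F 0 + pibar + eta1 <= c F 1).

Let pibar_ge0 : 0 <= pibar.
Proof.
have /(P1 ord0)/andP[h1 h2] : cube R n.+1 0.
  by move=> i; rewrite mxE in_itv/= lexx ler01.
exact: le_trans h2.
Qed.

Let pi_ge0 i x : cube R n.+1 x -> 0 <= pi i x. Proof. by move=> /(P1 i)/andP[]. Qed.

(** Exchanging players 0 and [i] leaves the law of identically distributed independent performances
    unchanged. *)
Let symmetric_expected i (F : cdf01 R) :
  expected (pi i) (fun=> F) = expected (pi ord0) (fun=> F).
Proof.
rewrite -[RHS](expected_perm (tperm ord0 i) F (pi_borel ord0) (@pi_ge0 ord0)).
apply: eq_Rintegral => t; rewrite inE => tc /=.
by rewrite P2// tpermL.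
Qed.

Let expected_total (Pi : 'rV[R]_n.+1 -> R) (F : cdf01 R) :
  (forall x, cube R n.+1 x -> \sum_(i < n.+1) pi i x = Pi x) ->
  expected (pi ord0) (fun=> F) = n.+1%:R^-1 * expected Pi (fun=> F).
Proof.
move=> PiE; suff -> : expected Pi (fun=> F) = n.+1%:R * expected (pi ord0) (fun=> F).
  by rewrite mulKf.
rewrite [LHS]expectedE.
transitivity (\int[product_law (fun _ : 'I_n.+1 => dF F)]_t \sum_i on_tuples (pi i) t).
  apply: eq_Rintegral => t _; rewrite /on_tuples patchE.
  under eq_bigr do rewrite patchE.
  case: ifPn => [|_]; last by rewrite big1.
  by rewrite inE -row_of_tuple_cube => tc; rewrite /= PiE.
rewrite (@Rintegral_prob_sum _ _ _ _ _ _ _ (fun=> pibar)); last 2 first.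
- by move=> i; exact: borel_on_tuples.
- move=> i t; rewrite ger0_norm; last exact/on_tuples_ge0/pi_ge0.
  by apply: on_tuples_le => // x /(P1 i)/andP[].
under eq_bigr do rewrite -expectedE symmetric_expected.
by rewrite sumr_const card_ord mulr_natl.
Qed.

(* By symmetry each player gets 1/n of the continuous total payoff, so payoffs
   are continuous along the diagonal although each one jumps at ties. *)
Let diagonal_continuous : continuous (fun F : cdf01 R => expected (pi ord0) (fun=> F)).
Proof.
have [Pi [_ cPi _ PiE]] := P5.
have -> : (fun F : cdf01 R => expected (pi ord0) (fun=> F)) =
    fun F => n.+1%:R^-1 * expected Pi (fun=> F).
  by apply/funext => F; exact: expected_total.
suff cE : continuous (fun F : cdf01 R => expected Pi (fun _ : 'I_n.+1 => F)).
  move=> F; have FF : Filter (nbhs F) := nbhs_filter F.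
  by apply: cvgMl_tmp; exact: cE.
apply: (@expected_continuous _ _ _ (n.+1%:R * pibar)) => //.
  have -> : on_tuples Pi = fun t => \sum_i on_tuples (pi i) t.
    apply/funext => t; rewrite /on_tuples patchE.
    under eq_bigr do rewrite patchE.
    case: ifPn => [|_]; last by rewrite big1.
    by rewrite inE -row_of_tuple_cube => tc; rewrite /= PiE.
  by apply: measurable_sum => i; exact: borel_on_tuples.
move=> x xc; rewrite -PiE// sumr_ge0/= => [|i _]; last exact: pi_ge0.
rewrite mulr_natl -[X in _ *+ X](card_ord n.+1) -sumr_const.
by apply: ler_sum => i _; case/andP: (P1 i xc).
Qed.

Let psi F := payoff_at (pi ord0) F \_ `[0, 1].

Let mpsi F : measurable_fun (setT : set (measurableTypeR R)) (psi F).
Proof. exact: measurable_payoff_at (pi_borel ord0) (P1 ord0) F. Qed.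

Let psi0M F x : 0 <= psi F x <= pibar.
Proof. exact: (payoff_at_bounds (pi_borel ord0) (P1 ord0)). Qed.

Let psib F x : `|psi F x| <= pibar.
Proof. by have /andP[? ?] := psi0M F x; rewrite ger0_norm. Qed.

Definition deviation_gain (H F : cdf01 R) : R :=
  (expected (pi ord0) (fun j => if j == ord0 then H else F) - C H) -
  (expected (pi ord0) (fun=> F) - C F).

(** Deviator and conformist face the same opponents, so both gross payoffs integrate the one
    function [psi F]. This makes the gross gain affine in [H] for fixed [F]. *)
Let gainE H F : deviation_gain H F =
  (\int[dF H]_x psi F x - C H) - (\int[dF F]_x psi F x - C F).
Proof.
rewrite /deviation_gain (expected_payoff_at (pi_borel ord0) (P1 ord0)).
rewrite -[X in _ - (X - _)](_ : expected (pi ord0) (fun j => if j == ord0 then F else F) = _).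
  by rewrite (expected_payoff_at (pi_borel ord0) (P1 ord0)).
by congr (expected _ _); apply/funext => j; case: ifP.
Qed.

Let gain_continuous H : (forall x, dF H [set x] = 0%:E) -> continuous (deviation_gain H).
Proof.
move=> H0 F; have FF : Filter (nbhs F) := nbhs_filter F.
apply: cvgB; last first.
  by apply: cvgB; [exact: diagonal_continuous|exact: C1_continuous].
apply: cvgB; last exact: cvg_cst.
under eq_fun do rewrite (expected_averaged (pi_borel ord0) (P1 ord0)).
rewrite (expected_averaged (pi_borel ord0) (P1 ord0)).
suff cE : continuous (fun F : cdf01 R =>
    expected (averaged_payoff (pi ord0) H) (fun _ : 'I_n => F)) by exact: cE.
apply: (@expected_continuous _ _ _ pibar).
- exact: (averaged_continuous (pi_borel ord0) (P1 ord0) H0 (@P3 ord0)).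
- exact: (measurable_averaged (pi_borel ord0) (P1 ord0)).
- by move=> y; exact: (averaged_bounds (pi_borel ord0) (P1 ord0)).
Qed.

Let finite_equilibrium k (H : 'I_k.+1 -> cdf01 R) :
  (forall j x, dF (H j) [set x] = 0%:E) ->
  exists F, forall j, deviation_gain (H j) F <= 0.
Proof.
move=> H0; pose Fa := convex_combination H.
have [a|a sa|a sa aP] := @simplex_variational R k (fun j a => deviation_gain (H j) (Fa a)).
- exact: (continuous_convex_combination (H := H) (gain_continuous (H0 a))).
- have [a0 a1] := sa.
  have avg (u : 'I_k.+1 -> R) v :
      \sum_j a ord0 j * (u j - v) = \sum_j a ord0 j * u j - v.
    by under eq_bigr do rewrite mulrBr; rewrite sumrB -mulr_suml a1 mul1r.
  have [mc [M cM]] := continuous_unit_patch (@C2_continuous (Fa a)).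
  have Epsi := Rintegral_convex_combination H sa (mpsi (Fa a)) (psib (Fa a)).
  have Ec := Rintegral_convex_combination H sa mc cM.
  have sub j := subgradient C1_convex C2_derivative (Fa a) (H j).
  (* Jensen's inequality for [k + 1] points, from the subgradients at [Fa a]: their weighted sum
     vanishes, because the integral against [Fa a] is the weighted mean of those against the
     [H j]. *)
  have sumC : C (Fa a) <= \sum_j a ord0 j * C (H j).
    have : \sum_j a ord0 j * (\int[dF (H j)]_x (c (Fa a) \_ `[0, 1]) x -
        \int[dF (Fa a)]_x (c (Fa a) \_ `[0, 1]) x) <=
        \sum_j a ord0 j * (C (H j) - C (Fa a)).
      apply: ler_sum => j _; apply: ler_wpM2l => //.
      by have := sub j; rewrite [X in X - _]Rintegral_mkcond [X in _ - X]Rintegral_mkcond.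
    by rewrite (avg (fun j => \int[dF (H j)]_x (c (Fa a) \_ `[0, 1]) x)) -Ec subrr (avg (C \o H)) subr_ge0.
  (* The gross payoffs cancel by linearity, and what remains is [sumC]. *)
  under eq_bigr do rewrite gainE.
  rewrite (avg (fun j => \int[dF (H j)]_x psi (Fa a) x - C (H j))).
  under eq_bigr do rewrite mulrBr.
  by rewrite sumrB -Epsi subr_le0 lerB.
by exists (Fa a).
Qed.

Let e0 : 0 <= (0 : R) <= 1. Proof. by rewrite lexx ler01. Qed.

Let combine (a b v x e : R) : a - b - v <= 0 -> x <= a - b + e -> x - v <= e.
Proof. by lra. Qed.

Lemma symmetric_equilibrium_exists : exists F, symmetric_equilibrium pi C ord0 F.
Proof.
pose D := [set H : cdf01 R | forall x, dF H [set x] = 0%:E].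
pose E (H : cdf01 R) := [set F | deviation_gain H F <= 0].
have fin : finI D E.
  move=> D' D'D; have [E0|] := eqVneq (enum_fset D') [::].
    (* The empty family imposes no condition; any cdf serves as the witness. *)
    exists (point_mass (b := 0) (R := R) e0) => H /=.
    by rewrite -[_ \in _]/(H \in enum_fset D') E0.
  case ED : (enum_fset D') => [//|H0 s] _.
  pose Hs (j : 'I_(size s).+1) := nth H0 (H0 :: s) j.
  have Hsmem j : Hs j \in D' by rewrite -[_ \in _]/(_ \in enum_fset D') ED mem_nth.
  have [F FP] := @finite_equilibrium (size s) Hs (fun j => set_mem (D'D _ (Hsmem j))).
  exists F => H /=; rewrite -[_ \in _]/(H \in enum_fset D') ED => Hin.
  have lt : (index H (H0 :: s) < (size s).+1)%N by rewrite index_mem.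
  by have := FP (Ordinal lt); rewrite /Hs /= nth_index.
have PF := finI_filter fin.
have [F [_ clF]] : [set: cdf01 R] `&` cluster (filter_from (finI_from D E) id) !=set0.
  apply: compact_cdf01; exact: filterT.
have gain0 H : D H -> deviation_gain H F <= 0.
  move=> DH.
  have : closed (E H).
    apply: (@preimage_closed _ _ (deviation_gain H) [set x | x <= 0]).
      by move=> G _; exact: gain_continuous.
    exact: closed_le.
  apply => B nB; apply: clF => //.
  exists (E H) => //; exact: finI_from1.
exists F => H; rewrite /net_payoff eqxx -subr_le0 -[_ - _]/(deviation_gain H F).
(* An arbitrary deviation is beaten by an atomless one only up to [e], so the bound on its gain is
   reached with a slack that is arbitrarily small. *)
apply/ler_addgt0Pr => e epos; rewrite add0r gainE.
have psi_homo := payoff_at_homo (pi_borel ord0) (P1 ord0) F (@P4 ord0).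
have psi_out x : x \notin `[0, 1]%R -> psi F x = 0.
  by move=> x01; rewrite /psi patchE memNset//; exact/negP.
have [G G0 HG] := atomless_deviation C1_convex C1_continuous C2_continuous
  C2_derivative eta1_gt0 C3 (mpsi F) (psi0M F) psi_homo psi_out H epos.
by have := gain0 G G0; rewrite gainE => gG; exact: combine gG HG.
Qed.

End equilibrium.

Theorem proposition3p1 (R : realType) (n : nat) (n_ge2 : (2 <= n)%N)
  (pi : 'I_n -> 'rV[R]_n -> R) (pibar : R)
  (C : cdf01 R -> R) (c : cdf01 R -> R -> R) (eta1 : R)
  (pi_borel : forall i, borel_on_cube (pi i))
  (P1 : forall i x, cube R n x -> 0 <= pi i x <= pibar)
  (P2 : forall (s : 'S_n) i x, cube R n x -> pi i (col_perm s x) = pi (s i) x)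
  (P3 : forall i x, cube R n x -> (forall j, j != i -> x ord0 i != x ord0 j) ->
    pi i y @[y --> within (cube R n) (nbhs x)] --> pi i x)
  (P4 : forall i x x', cube R n x -> cube R n x' ->
    (forall j, j != i -> x' ord0 j = x ord0 j) -> x ord0 i <= x' ord0 i ->
    pi i x <= pi i x')
  (P5 : exists Pi : 'rV[R]_n -> R,
    [/\ exists M, forall x, cube R n x -> `|Pi x| <= M,
        {within cube R n, continuous Pi},
        forall (s : 'S_n) x, cube R n x -> Pi (col_perm s x) = Pi x &
        forall x, cube R n x -> \sum_(i < n) pi i x = Pi x])
  (C1_convex : forall (t : R) (F G : cdf01 R), 0 <= t <= 1 ->
    C (mix t F G) <= (1 - t) * C F + t * C G)
  (C1_continuous : continuous C)
  (C2_continuous : forall F, {within `[0, 1], continuous (c F)})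
  (C2_derivative : forall F G : cdf01 R,
    e^-1 * (C (mix e F G) - C F) @[e --> 0^'+] -->
      \int[dF G]_(x in `[0, 1]) c F x - \int[dF F]_(x in `[0, 1]) c F x)
  (eta1_gt0 : 0 < eta1)
  (C3 : forall F, c F 0 + pibar + eta1 <= c F 1) :
  exists Fstar : cdf01 R,
    symmetric_equilibrium pi C (Ordinal (ltnW n_ge2)) Fstar.
Proof.
case: n => [|n] in n_ge2 pi pi_borel P1 P2 P3 P4 P5 *; first by [].
have -> : Ordinal (ltnW n_ge2) = ord0 by apply: val_inj.
exact: (symmetric_equilibrium_exists pi_borel P1 P2 P3 P4 P5 C1_convex
  C1_continuous C2_continuous C2_derivative eta1_gt0 C3).
Qed.
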